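(* Let $\mathcal{X},\mathcal{Y}\subset\mathbb{R}^d$ be compact with $\mathcal{X}$ convex, let $\mu$ and $\nu$ be Borel probability measures with supports $\mathcal{X}$ and $\mathcal{Y}$ respectively, let $\lambda>0$, and let $c(x,y)=-\langle x,y\rangle$. If $\mu$ admits a log-concave density on $\mathcal{X}$, then for any integer $t\ge 0$ the dual sub-optimality gap $\delta_t$ of Sinkhorn's iterates satisfies $$\delta_t\le \delta_0\,(1-\alpha^{-1})^t,\qquad\text{where } \alpha=176\Big(1+\frac{c_\infty}{\lambda}\Big).$$
   Context: Densities are with respect to Lebesgue measure on $\mathbb{R}^d$. $c_\infty=\sup_{\mathcal{X}\times\mathcal{Y}}c-\inf_{\mathcal{X}\times\mathcal{Y}}c$. For $\phi\in L^\infty(\mu)$ and $\psi\in L^\infty(\nu)$, the $(c,\lambda)$-transforms are $$\phi^{c,\lambda}(y)=-\lambda\log\int \exp\Big(\frac{\phi(x)-c(x,y)}{\lambda}\Big)d\mu(x),\qquad \psi^{c,\lambda}(x)=-\lambda\log\int \exp\Big(\frac{\psi(y)-c(x,y)}{\lambda}\Big)d\nu(y).$$ The dual functional is $$F(\phi,\psi)=\int\phi\,d\mu+\int\psi\,d\nu+\lambda\Big(1-\iint \exp\Big(\frac{\phi(x)+\psi(y)-c(x,y)}{\lambda}\Big)d\mu(x)d\nu(y)\Big).$$ Sinkhorn's iterates start from an arbitrary $\psi_0\in L^\infty(\nu)$ and are defined by $\phi_{t+1/2}=\psi_t^{c,\lambda}$, $\psi_{t+1}=\phi_{t+1/2}^{c,\lambda}$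 for integers $t\ge0$. The dual sub-optimality gap is $$\delta_t=\sup_{\phi\in L^\infty(\mu),\,\psi\in L^\infty(\nu)}F(\phi,\psi)-F(\phi_{t+1/2},\psi_t).$$ *)

(* Defs.v *)
From HB Require Import structures.
From mathcomp Require Import all_boot all_order all_algebra.
From mathcomp Require Import all_classical all_reals all_analysis.
From mathcomp Require Import measurable_realfun.

Set Implicit Arguments.
Unset Strict Implicit.
Unset Printing Implicit Defensive.

Import Order.TTheory GRing.Theory Num.Theory.
Import numFieldNormedType.Exports.

Local Open Scope classical_set_scope.
Local Open Scope ring_scope.

(* Borel sigma-algebra of the usual topology. *)
Section borel_matrix.
Variables (R : realType) (m n : nat).
Let opens : set_system 'M[R]_(m, n) := @open 'M[R]_(m, n).

HB.instance Definition _ := @isMeasurable.Build (sigma_display opens)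
  'M[R]_(m, n) <<s opens >> (@sigma_algebra0 _ setT opens)
  (@sigma_algebraC _ opens) (@sigma_algebra_bigcup _ setT opens).

End borel_matrix.

Lemma rV_measurableE (R : realType) (n : nat) :
  @measurable _ 'rV[R]_n = <<s @open 'rV[R]_n >>.
Proof. by []. Qed.

Lemma open_measurable_rV (R : realType) (n : nat) (U : set 'rV[R]_n) :
  open U -> measurable U.
Proof. by move=> oU; rewrite rV_measurableE; exact: sub_sigma_algebra. Qed.

Lemma measurable_coord (R : realType) (n : nat) (j : 'I_n) :
  measurable_fun [set: 'rV[R]_n] (fun x => x ord0 j).
Proof.
apply: (measurability _ (@RGenOpens.measurableE R)) => _ [_ [a [b ->]] <-].
rewrite setTI.
apply: open_measurable_rV.
apply: open_comp => [x _|]; last exact: interval_open.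
exact: coord_continuous.
Qed.

Section measurable_rV.
Context {R : realType} {d : measure_display} {T : measurableType d} {n : nat}.

Let ratball (q : 'rV[rat]_n * rat) : set 'rV[R]_n :=
  @ball R 'rV[R]_n (map_mx ratr q.1) (ratr q.2).

Let open_ratball (U : set 'rV[R]_n) : open U ->
  U = \bigcup_q (if `[< ratball q `<=` U >] then ratball q else set0).
Proof.
move=> oU; rewrite eqEsubset; split => [x Ux|x [q _]]; last first.
  by case: asboolP => // qU; exact: qU.
have := open_nbhs_nbhs (conj oU Ux).
rewrite -nbhs_ballE => -[e /= e0 xeU].
have [r] := @rat_in_itvoo R (e / 4) (e / 2)
  ltac:(by rewrite ltr_pM2l// ltf_pV2 ?posrE// ltr_nat).
rewrite in_itv/= => /andP[r1 r2].
have r0 : 0 < ratr r :> R by rewrite (lt_trans _ r1)// divr_gt0.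
have /choice[q qx] (j : 'I_n) :
    exists q : rat, x ord0 j - ratr r < (ratr q : R) < x ord0 j + ratr r.
  have [q] := @rat_in_itvoo R (x ord0 j - ratr r) (x ord0 j + ratr r)
    ltac:(by rewrite ltrD2l (lt_trans _ r0)// oppr_lt0).
  by rewrite in_itv/=; exists q.
have xq : @ball R 'rV[R]_n x (ratr r) (map_mx ratr (\row_j q j)).
  split => // i j; rewrite !mxE (ord1 i) /ball/= distrC ltr_distl.
  exact: qx.
exists (\row_j q j, r) => //; case: asboolP => [_|nU]; first exact: ball_sym.
exfalso; apply: nU => y yq; apply: xeU.
apply: (@le_ball _ _ _ (ratr r + ratr r)); last exact: ball_triangle xq yq.
by rewrite (splitr e) lerD// ltW.
Qed.

Lemma measurable_fun_rV (f : T -> 'rV[R]_n) :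
  (forall j, measurable_fun [set: T] (fun t => f t ord0 j)) ->
  measurable_fun [set: T] f.
Proof.
move=> mf; apply: (measurability _ (rV_measurableE R n)).
move=> _ [U oU <-]; rewrite setTI (open_ratball oU) preimage_bigcup.
apply: countable_bigcupT_measurable => // q.
case: asboolP => _; last by rewrite preimage_set0.
have [q0|q0] := ltP 0 (ratr q.2 : R); last first.
  rewrite [X in measurable X](_ : _ = set0)// -subset0 => t [].
  by rewrite ltNge q0.
rewrite [X in measurable X](_ : _ = \bigcap_(j in [set: 'I_n])
  (fun t => f t ord0 j) @^-1` ball (ratr (q.1 ord0 j) : R) (ratr q.2 : R)).
  apply: fin_bigcap_measurable; first exact: finite_finset.
  by move=> j _; rewrite -[X in measurable X]setTI; apply: mf => //;
    exact: measurable_ball.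
apply/seteqP; split => [t [_ qt] j _|t qt] /=.
  by have := qt ord0 j; rewrite mxE.
by split => // i j; rewrite (ord1 i) mxE; exact: qt.
Qed.

End measurable_rV.

Section lebesgue_rV.
Variable R : realType.

Definition cons_rV n (p : measurableTypeR R * 'rV[R]_n) : 'rV[R]_n.+1 :=
  \row_i oapp (p.2 ord0) p.1 (unlift ord0 i).

Definition uncons_rV n (x : 'rV[R]_n.+1) : measurableTypeR R * 'rV[R]_n :=
  (x ord0 ord0, \row_j x ord0 (lift ord0 j)).

Lemma cons_rVK n : cancel (@cons_rV n) (@uncons_rV n).
Proof.
move=> [a y]; congr pair; first by rewrite mxE unlift_none.
by apply/rowP => j; rewrite !mxE liftK.
Qed.

Lemma measurable_cons_rV n : measurable_fun setT (@cons_rV n).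
Proof.
apply: measurable_fun_rV => i; case: (unliftP ord0 i) => [j|] ->.
  under eq_fun do rewrite mxE liftK /=.
  exact: (measurableT_comp (measurable_coord _) measurable_snd).
under eq_fun do rewrite mxE unlift_none /=.
exact: measurable_fst.
Qed.

Lemma measurable_uncons_rV n : measurable_fun setT (@uncons_rV n).
Proof.
apply: measurable_fun_pair; first exact: measurable_coord.
apply: measurable_fun_rV => j; under eq_fun do rewrite mxE.
exact: measurable_coord.
Qed.

Section step.
Variables (n : nat) (m : {sigma_finite_measure set 'rV[R]_n -> \bar R}).

Definition lebesgue_rV_step : set 'rV[R]_n.+1 -> \bar R :=
  pushforward (@lebesgue_measure R \x m)%E (@cons_rV n).

HB.instance Definition _ := Measure.copy lebesgue_rV_step
  (measure_function_pushforward__canonical__measure_function_Measure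
     (@lebesgue_measure R \x m)%E (@measurable_cons_rV n)).

Let sigma_finite_step : sigma_finite setT lebesgue_rV_step.
Proof.
have /sigma_finiteP[F [TF ndF Foo]] := sigma_finiteT (@lebesgue_measure R).
have /sigma_finiteP[G [TG ndG Goo]] := sigma_finiteT m.
exists (fun k => @uncons_rV n @^-1` (F k `*` G k)).
  rewrite -preimage_bigcup -(@preimage_setT _ _ (@uncons_rV n)); congr preimage.
  rewrite -setXTT TF TG predeqE => -[x y]; split.
    move=> [/= [i _ Fix_] [k _ Gky]]; exists (maxn i k) => //; split.
    - by move: x Fix_; exact/subsetPset/ndF/leq_maxl.
    - by move: y Gky; exact/subsetPset/ndG/leq_maxr.
  by move=> [i _ []/= ? ?]; split; exists i.
move=> k; have [mF Fk] := Foo k; have [mG Gk] := Goo k; split.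
  rewrite -[X in measurable X]setTI; apply: measurable_uncons_rV => //.
  exact: measurableX.
rewrite /lebesgue_rV_step /pushforward -comp_preimage.
rewrite (_ : _ \o _ = id); last by apply/funext => p; exact: cons_rVK.
by rewrite preimage_id product_measure1E// lte_mul_pinfty// ge0_fin_numE.
Qed.

HB.instance Definition _ := Measure_isSigmaFinite.Build _ _ _
  lebesgue_rV_step sigma_finite_step.

End step.

(* Lebesgue measure on the Borel sets of R^n, as an iterated product; it is
   characterised by its values on boxes, see lebesgue_rV_box. *)
Fixpoint lebesgue_rV n : {sigma_finite_measure set 'rV[R]_n -> \bar R} :=
  match n with
  | 0 => dirac (0 : 'rV[R]_0)
  | n'.+1 => lebesgue_rV_step (lebesgue_rV n')
  end.

Definition box_rV n (a b : 'rV[R]_n) : set 'rV[R]_n :=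
  [set x | forall i, x ord0 i \in `[a ord0 i, b ord0 i]].

Lemma measurable_box_rV n (a b : 'rV[R]_n) : measurable (box_rV a b).
Proof.
rewrite [X in measurable X](_ : _ = \bigcap_(i in [set: 'I_n])
    (fun x : 'rV[R]_n => x ord0 i) @^-1` [set` `[a ord0 i, b ord0 i]]).
  apply: fin_bigcap_measurable; first exact: finite_finset.
  move=> i _; rewrite -[X in measurable X]setTI.
  by apply: measurable_coord => //; exact: measurable_itv.
by apply/seteqP; split => x /= xab i; [move=> _; exact: xab|exact: (xab i I)].
Qed.

Lemma lebesgue_rV_box n (a b : 'rV[R]_n) :
  (forall i, a ord0 i <= b ord0 i) ->
  lebesgue_rV n (box_rV a b) = (\prod_i (b ord0 i - a ord0 i))%:E.
Proof.
elim: n a b => [|n IHn] a b ab.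
  by rewrite big_ord0 /= diracE mem_set// => -[].
pose a' : 'rV_n := \row_j a ord0 (lift ord0 j).
pose b' : 'rV_n := \row_j b ord0 (lift ord0 j).
transitivity ((@lebesgue_measure R \x lebesgue_rV n)
    ([set` `[a ord0 ord0, b ord0 ord0]] `*` box_rV a' b'))%E.
  congr (product_measure1 _ _ _).
  apply/seteqP; split => [[r x] /= xab|[r x] /= [rab xab] i].
    split; first by have := xab ord0; rewrite mxE unlift_none.
    by move=> i; have := xab (lift ord0 i); rewrite !mxE liftK.
  rewrite mxE; case: (unliftP ord0 i) => [j|] -> //=.
  by have := xab j; rewrite !mxE.
rewrite product_measure1E//; last exact: measurable_box_rV.
rewrite IHn; last by move=> i; rewrite !mxE.
rewrite big_ord_recl EFinM; congr (_ * _)%E; last first.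
  by congr EFin; apply: eq_bigr => i _; rewrite !mxE.
apply: (eq_trans (lebesgue_measure_itv `[a ord0 ord0, b ord0 ord0])).
rewrite /= lte_fin; case: ltP => // ba; congr EFin.
by apply/esym/eqP; rewrite subr_eq0 eq_le ba ab.
Qed.

End lebesgue_rV.

Section sinkhorn.
Context {R : realType} {d1 d2 : measure_display}.
Context {T1 : measurableType d1} {T2 : measurableType d2}.
Variables (mu : probability T1 R) (nu : probability T2 R).
Variables (c : T1 -> T2 -> R) (lambda : R).

(* The (c, lambda)-transforms phi^(c, lambda) and psi^(c, lambda). *)
Definition transformX (phi : T1 -> R) (y : T2) : R :=
  - lambda * ln (\int[mu]_x expR ((phi x - c x y) / lambda)).

Definition transformY (psi : T2 -> R) (x : T1) : R :=
  - lambda * ln (\int[nu]_y expR ((psi y - c x y) / lambda)).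

Definition dual_fun (phi : T1 -> R) (psi : T2 -> R) : R :=
  \int[mu]_x phi x + \int[nu]_y psi y +
  lambda * (1 - \int[nu]_y \int[mu]_x expR ((phi x + psi y - c x y) / lambda)).

Definition sinkhorn_psi (psi0 : T2 -> R) (t : nat) : T2 -> R :=
  iter t (transformX \o transformY) psi0.

(* sinkhorn_phi psi0 t is the half-step iterate phi_(t + 1/2) *)
Definition sinkhorn_phi (psi0 : T2 -> R) (t : nat) : T1 -> R :=
  transformY (sinkhorn_psi psi0 t).

(* The supremum is taken in \bar R because real suprema of unbounded sets are
   conventionally 0; Lfun mu +oo is the set of functions (not of classes) that
   are measurable and essentially bounded. *)
Definition dual_sup : \bar R :=
  ereal_sup [set (dual_fun p.1 p.2)%:E | p in
    [set p : (T1 -> R) * (T2 -> R) |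
      p.1 \in Lfun mu +oo%E /\ p.2 \in Lfun nu +oo%E]].

Definition dual_gap (psi0 : T2 -> R) (t : nat) : \bar R :=
  (dual_sup - (dual_fun (sinkhorn_phi psi0 t) (sinkhorn_psi psi0 t))%:E)%E.

End sinkhorn.

Section euclidean.
Context {R : realType} {d : nat}.

Definition dotp (x y : 'rV[R]_d) : R := \sum_i x ord0 i * y ord0 i.

Definition dot_cost (x y : 'rV[R]_d) : R := - dotp x y.

Definition msupport (mu : set 'rV[R]_d -> \bar R) : set 'rV[R]_d :=
  [set x | forall U, open U -> U x -> (0 < mu U)%E].

(* f may vanish on X: 0 `^ t = 0 for t != 0, and the inequality is trivial for
   t = 0 and t = 1, where u `^ 0 = 1 and u `^ 1 = u for every u >= 0. *)
Definition log_concave_on (X : set 'rV[R]_d) (f : 'rV[R]_d -> R) :=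
  forall x y t, X x -> X y -> 0 <= t <= 1 ->
    f x `^ t * f y `^ (1 - t) <= f (t *: x + (1 - t) *: y).

Definition is_density (mu : set 'rV[R]_d -> \bar R) (f : 'rV[R]_d -> R) :=
  [/\ measurable_fun setT f, forall x, 0 <= f x &
    forall A, measurable A ->
      mu A = (\int[lebesgue_rV R d]_(x in A) (f x)%:E)%E].

(* c_infty *)
Definition cost_osc (c : 'rV[R]_d -> 'rV[R]_d -> R) (X Y : set 'rV[R]_d) : R :=
  sup [set c x y | x in X & y in Y] - inf [set c x y | x in X & y in Y].

End euclidean.

(* Main.v *)
Require Import Defs.
From HB Require Import structures.
From mathcomp Require Import all_boot all_order all_algebra.
From mathcomp Require Import all_classical all_reals all_analysis.
From mathcomp Require Import measurable_realfun ess_sup_inf ring lra.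

(** Let [phi], [psi] be the current iterates, [psi' = phi^c], [phi' = psi'^c],
    and let [phi*] be the transform of a nearly optimal [psi*]. Concavity of
    the dual functional bounds [F* - F(phi, psi')] by the mean of
    [(phi* - phi) (1 - p)], where [p] is the [mu]-density of the first marginal
    of the coupling of [(phi, psi')]. By duality between entropy and
    exponential moments, for every [A] of order at least [c_infty] this is at
    most [A KL(mu | p mu) + Var(phi* - phi) / A], and [lambda KL(mu | p mu)] is
    exactly the increment [F(phi', psi') - F(phi, psi')].

    The variance is controlled by the gap: [psi^c (x)] is jointly concave in
    [psi] and [x], so for log-concave [mu] the Prekopa-Leindler inequality
    makes [psi |-> log int expR (a psi^c) dmu] midpoint concave. With [a] of
    order [1 / c_infty] the exponentials are bounded, and comparing with the
    mean of [psi^c] at the midpoint of [psi] and [psi*] gives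
    [Var(phi* - phi) <= 44 (lambda + c_infty) gap]. Choosing
    [A = 88 (lambda + c_infty)] absorbs half of the gap and leaves
    [gap <= alpha (F(phi', psi') - F(phi, psi))].

    The Prekopa-Leindler inequality is needed at midpoints only; it tensorises
    by Tonelli's theorem from the line, where it follows from the
    Brunn-Minkowski inequality for superlevel sets. *)

Set Implicit Arguments.
Unset Strict Implicit.
Unset Printing Implicit Defensive.

Import Order.TTheory GRing.Theory Num.Theory.
Import numFieldNormedType.Exports.

Local Open Scope classical_set_scope.
Local Open Scope ring_scope.

(** * Bounded measurable functions *)

Section bounded_measurable.
Context {R : realType} {d : measure_display} {T : measurableType d}.
Implicit Types f g : T -> R.

(** The bound holds everywhere, not just almost everywhere, so pointwise inequalities integrate
    directly. Essentially bounded potentials are reduced to this class before the final estimate. *)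
Definition bddm f := measurable_fun setT f /\ exists M, forall x, `|f x| <= M.

Lemma bddm_cst (r : R) : bddm (fun=> r).
Proof. by split; [exact: measurable_cst|exists `|r|]. Qed.

Lemma bddmD f g : bddm f -> bddm g -> bddm (fun x => f x + g x).
Proof.
move=> [mf [M fM]] [mg [N gN]]; split; first exact: measurable_funD.
by exists (M + N) => x; rewrite (le_trans (ler_normD _ _))// lerD.
Qed.

Lemma bddmN f : bddm f -> bddm (fun x => - f x).
Proof.
move=> [mf [M fM]]; split; first exact: measurableT_comp.
by exists M => x; rewrite normrN.
Qed.

Lemma bddmB f g : bddm f -> bddm g -> bddm (fun x => f x - g x).
Proof. by move=> bf /bddmN; exact: bddmD. Qed.

Lemma bddmM f g : bddm f -> bddm g -> bddm (fun x => f x * g x).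
Proof.
move=> [mf [M fM]] [mg [N gN]]; split; first exact: measurable_funM.
by exists (M * N) => x; rewrite normrM ler_pM.
Qed.

Lemma bddm_expR f : bddm f -> bddm (fun x => expR (f x)).
Proof.
move=> [mf [M fM]]; split; first exact: measurableT_comp.
exists (expR M) => x; rewrite ger0_norm ?expR_ge0// ler_expR.
by rewrite (le_trans (ler_norm _))// fM.
Qed.

Lemma bddm_ln f (e : R) : 0 < e -> (forall x, e <= f x) -> bddm f ->
  bddm (fun x => ln (f x)).
Proof.
move=> e0 ef [mf [M fM]]; split; first exact: measurableT_comp.
exists (`|ln e| + `|ln M|) => x.
have f0 : 0 < f x by exact: lt_le_trans (ef x).
have fxM : f x <= M by rewrite (le_trans (ler_norm _)).
have le1 : ln e <= ln (f x) by rewrite ler_ln// posrE.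
have le2 : ln (f x) <= ln M by rewrite ler_ln// posrE (lt_le_trans f0).
rewrite ler_norml; apply/andP; split.
  by rewrite lerNl (le_trans (y := - ln e)) ?lerN2// (le_trans (ler_norm _))//
    normrN lerDl.
by rewrite (le_trans le2)// (le_trans (ler_norm _))// lerDr.
Qed.

End bounded_measurable.

Lemma bddm_comp {R : realType} {d d' : measure_display} {T : measurableType d}
    {T' : measurableType d'} (h : T' -> R) (g : T -> T') :
  measurable_fun setT g -> bddm h -> bddm (fun x => h (g x)).
Proof.
move=> mg [mh [M hM]]; split; first exact: measurableT_comp.
by exists M.
Qed.

Section mean.
Context {R : realType} {d : measure_display} {T : measurableType d}.
Variable P : probability T R.
Implicit Types f g : T -> R.

Lemma bddm_integrable f : bddm f -> P.-integrable setT (EFin \o f).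
Proof.
move=> [mf [M fM]]; apply: measurable_bounded_integrable => //.
  by rewrite (le_lt_trans (probability_le1 P measurableT))// ltry.
exists M; split; first exact: num_real.
by move=> y My x _; rewrite /= (le_trans (fM x))// ltW.
Qed.

Lemma mean_cst (r : R) : \int[P]_x r = r.
Proof.
by rewrite Rintegral_cst// [X in fine X](probability_setT P) mulr1.
Qed.

Lemma meanD f g : bddm f -> bddm g ->
  \int[P]_x (f x + g x) = \int[P]_x f x + \int[P]_x g x.
Proof. by move=> bf bg; rewrite RintegralD//; exact: bddm_integrable. Qed.

Lemma meanB f g : bddm f -> bddm g ->
  \int[P]_x (f x - g x) = \int[P]_x f x - \int[P]_x g x.
Proof. by move=> bf bg; rewrite RintegralB//; exact: bddm_integrable. Qed.

Lemma meanZ f (r : R) : bddm f -> \int[P]_x (r * f x) = r * \int[P]_x f x.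
Proof. by move=> bf; rewrite RintegralZl//; exact: bddm_integrable. Qed.

Lemma meanZr f (r : R) : bddm f -> \int[P]_x (f x * r) = \int[P]_x f x * r.
Proof. by move=> bf; rewrite RintegralZr//; exact: bddm_integrable. Qed.

Lemma meanN f : bddm f -> \int[P]_x (- f x) = - \int[P]_x f x.
Proof.
by move=> bf; under eq_Rintegral do rewrite -mulN1r; rewrite meanZ// mulN1r.
Qed.

Lemma le_mean f g : bddm f -> bddm g -> (forall x, f x <= g x) ->
  \int[P]_x f x <= \int[P]_x g x.
Proof.
by move=> bf bg fg; apply: le_Rintegral => //; exact: bddm_integrable.
Qed.

Lemma mean_ge f (r : R) : bddm f -> (forall x, r <= f x) -> r <= \int[P]_x f x.
Proof.
by move=> bf rf; rewrite -[leLHS]mean_cst; apply: le_mean => //; exact: bddm_cst.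
Qed.

Lemma mean_le f (r : R) : bddm f -> (forall x, f x <= r) -> \int[P]_x f x <= r.
Proof.
by move=> bf rf; rewrite -[leRHS]mean_cst; apply: le_mean => //; exact: bddm_cst.
Qed.

Lemma mean_expR_gt0 f : bddm f -> 0 < \int[P]_x expR (f x).
Proof.
move=> bf; have [mf [M fM]] := bf.
rewrite (@lt_le_trans _ _ (expR (- M))) ?expR_gt0//.
apply: mean_ge => [|x]; first exact: bddm_expR.
by rewrite ler_expR lerNl (le_trans (ler_norm _))// normrN.
Qed.

(* AM-GM on the normalised exponentials gives the Cauchy-Schwarz inequality in
   logarithmic form. *)
Lemma ln_mean_expR_midpoint f g h : bddm f -> bddm g -> bddm h ->
  (forall x, h x <= (f x + g x) / 2) ->
  ln (\int[P]_x expR (h x)) <=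
  (ln (\int[P]_x expR (f x)) + ln (\int[P]_x expR (g x))) / 2.
Proof.
move=> bf bg bh hfg.
set a := ln (\int[P]_x expR (f x)); set b := ln (\int[P]_x expR (g x)).
have ea : expR a = \int[P]_x expR (f x) by rewrite lnK// posrE mean_expR_gt0.
have eb : expR b = \int[P]_x expR (g x) by rewrite lnK// posrE mean_expR_gt0.
rewrite -ler_expR lnK ?posrE ?mean_expR_gt0//.
move: a b ea eb => a b ea eb.
set m := (a + b) / 2.
have amgm (x : T) : expR (h x) <=
    expR m / 2 * (expR (f x) * expR (- a) + expR (g x) * expR (- b)).
  have hx : h x <= m + ((f x - a) / 2 + (g x - b) / 2).
    by have := hfg x; rewrite /m; clear; lra.
  apply: (@le_trans _ _ (expR (m + ((f x - a) / 2 + (g x - b) / 2)))).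
    by rewrite ler_expR.
  have sq (r : R) : expR r = expR (r / 2) ^+ 2.
    by rewrite -expRM_natr; congr expR; rewrite divfK.
  rewrite -!(expRD _ (- _)) (sq (f x - a)) (sq (g x - b)) !expRD.
  have := sqr_ge0 (expR ((f x - a) / 2) - expR ((g x - b) / 2)).
  rewrite -mulrA ler_pM2l ?expR_gt0//.
  move: (expR _) (expR _) => u v; clear; lra.
apply: (le_trans (le_mean _ _ amgm)); first exact: bddm_expR.
  apply: bddmM; first exact: bddm_cst.
  by apply: bddmD; apply: bddmM; (exact: bddm_cst || exact: bddm_expR).
rewrite meanZ; last first.
  by apply: bddmD; apply: bddmM; (exact: bddm_cst || exact: bddm_expR).
rewrite meanD; [|by apply: bddmM; (exact: bddm_cst || exact: bddm_expR)..].
rewrite !meanZr; [|exact: bddm_expR..].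
by rewrite -ea -eb -!expRD !subrr !expR0; lra.
Qed.

End mean.

(** * Fubini's theorem for bounded functions *)

Section product.
Context {R : realType} {d1 d2 : measure_display}.
Context {T1 : measurableType d1} {T2 : measurableType d2}.
Variables (P : probability T1 R) (Q : probability T2 R).
Implicit Type h : T1 * T2 -> R.

Lemma bddm_fst (f : T1 -> R) : bddm f -> bddm (fun z : T1 * T2 => f z.1).
Proof. by apply: bddm_comp; exact: measurable_fst. Qed.

Lemma bddm_snd (f : T2 -> R) : bddm f -> bddm (fun z : T1 * T2 => f z.2).
Proof. by apply: bddm_comp; exact: measurable_snd. Qed.

Lemma bddm_section1 h y : bddm h -> bddm (fun x => h (x, y)).
Proof. by apply: bddm_comp; exact: measurable_pair2. Qed.

Lemma bddm_section2 h x : bddm h -> bddm (fun y => h (x, y)).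
Proof. by apply: bddm_comp; exact: measurable_pair1. Qed.

Let nonneg_case h : bddm h -> (forall z, 0 <= h z) ->
  [/\ bddm (fun y => \int[P]_x h (x, y)), bddm (fun x => \int[Q]_y h (x, y)) &
    \int[Q]_y \int[P]_x h (x, y) = \int[P]_x \int[Q]_y h (x, y)].
Proof.
move=> bh h0; have [mh [M hM]] := bh.
have mh' : measurable_fun setT (EFin \o h) by exact/measurable_EFinP.
have h0' z : (0 <= (EFin \o h) z)%E by rewrite lee_fin.
have fin1 y : (\int[P]_x (h (x, y))%:E)%E = (\int[P]_x h (x, y))%:E.
  rewrite fineK//; apply: integrable_fin_num => //.
  exact: bddm_integrable (bddm_section1 _ bh).
have fin2 x : (\int[Q]_y (h (x, y))%:E)%E = (\int[Q]_y h (x, y))%:E.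
  rewrite fineK//; apply: integrable_fin_num => //.
  exact: bddm_integrable (bddm_section2 _ bh).
have hM' z : h z <= M by rewrite (le_trans (ler_norm _)).
split.
- split.
    apply/measurable_EFinP.
    apply: (eq_measurable_fun (fubini_G P (EFin \o h))) => [y _|].
      exact: fin1.
    exact: (measurable_fun_fubini_tonelli_G (m1 := P) _ mh' h0').
  exists M => y; rewrite ger0_norm; last exact: Rintegral_ge0.
  by apply: mean_le => //; exact: bddm_section1.
- split.
    apply/measurable_EFinP.
    apply: (eq_measurable_fun (fubini_F Q (EFin \o h))) => [x _|].
      exact: fin2.
    exact: (measurable_fun_fubini_tonelli_F (m2 := Q) _ mh' h0').
  exists M => y; rewrite ger0_norm; last exact: Rintegral_ge0.
  by apply: mean_le => //; exact: bddm_section2.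
- rewrite [LHS]/Rintegral [RHS]/Rintegral; congr fine.
  under eq_integral do rewrite -fin1.
  under [RHS]eq_integral do rewrite -fin2.
  exact/esym/(fubini_tonelli (m1 := P) (m2 := Q) _ mh' h0').
Qed.

(** Adding the bound [M] makes the integrand nonnegative, so Tonelli's theorem applies; the constant
    is subtracted afterwards. *)
Lemma mean_fubini h : bddm h ->
  [/\ bddm (fun y => \int[P]_x h (x, y)), bddm (fun x => \int[Q]_y h (x, y)) &
    \int[Q]_y \int[P]_x h (x, y) = \int[P]_x \int[Q]_y h (x, y)].
Proof.
move=> bh; have [mh [M hM]] := bh.
pose k z := h z + M.
have bk : bddm k by apply: bddmD => //; exact: bddm_cst.
have k0 z : 0 <= k z.
  by rewrite /k -lerBlDr sub0r lerNl (le_trans (ler_norm _))// normrN.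
have E1 y : \int[P]_x h (x, y) = \int[P]_x k (x, y) - M.
  rewrite meanD ?mean_cst ?addrK//; first exact: bddm_section1.
  exact: bddm_cst.
have E2 x : \int[Q]_y h (x, y) = \int[Q]_y k (x, y) - M.
  rewrite meanD ?mean_cst ?addrK//; first exact: bddm_section2.
  exact: bddm_cst.
have [b1 b2 eq12] := nonneg_case bk k0.
split.
- by under eq_fun do rewrite E1; apply: bddmB => //; exact: bddm_cst.
- by under eq_fun do rewrite E2; apply: bddmB => //; exact: bddm_cst.
under eq_Rintegral do rewrite E1; under [RHS]eq_Rintegral do rewrite E2.
by rewrite !meanB ?mean_cst ?eq12//; exact: bddm_cst.
Qed.

End product.

(** * Transforms and the dual functional *)

Section transform.
Context {R : realType} {d1 d2 : measure_display}.
Context {T1 : measurableType d1} {T2 : measurableType d2}.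
Variables (mu : probability T1 R) (c : T1 -> T2 -> R) (lambda : R).
Hypothesis lambda0 : 0 < lambda.
Hypothesis bc : bddm (fun z : T1 * T2 => c z.1 z.2).
Implicit Types (phi : T1 -> R) (y : T2).

Local Notation TX := (transformX mu c lambda).

Lemma bddm_kernel phi (r : R) y : bddm phi ->
  bddm (fun x => (phi x + r - c x y) / lambda).
Proof.
move=> bphi; apply: bddmM; last exact: bddm_cst.
apply: bddmB; first by apply: bddmD => //; exact: bddm_cst.
exact: (bddm_section1 y bc).
Qed.

Lemma bddm_cost phi y : bddm phi -> bddm (fun x => (phi x - c x y) / lambda).
Proof.
by move=> bphi; have := bddm_kernel 0 y bphi; under eq_fun do rewrite addr0.
Qed.

(** The constant [r] factors out of the exponential, and what remains is the integral defining
    [TX phi y]. For [r = TX phi y] the value is [1]: the kernel is then a probability density with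
    respect to [mu]. *)
Lemma transformX_kernel phi (r : R) y : bddm phi ->
  \int[mu]_x expR ((phi x + r - c x y) / lambda) =
  expR ((r - TX phi y) / lambda).
Proof.
move=> bphi; rewrite /transformX.
transitivity (\int[mu]_x (expR (r / lambda) * expR ((phi x - c x y) / lambda))).
  by apply: eq_Rintegral => x _; rewrite -expRD; congr expR; ring.
rewrite meanZ; last exact/bddm_expR/bddm_cost.
have := mean_expR_gt0 mu (bddm_cost y bphi).
move: (Rintegral _ _ _) => I I0.
rewrite (_ : (r - _) / lambda = r / lambda + ln I); last first.
  by field; rewrite gt_eqF.
by rewrite expRD lnK.
Qed.

Lemma bddm_transformX phi : bddm phi -> bddm (TX phi).
Proof.
move=> bphi.
have bh : bddm (fun z : T1 * T2 => (phi z.1 - c z.1 z.2) / lambda).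
  apply: bddmM; last exact: bddm_cst.
  by apply: bddmB => //; exact: bddm_fst.
have [_ [M hM]] := bh.
apply: bddmM; first exact: bddm_cst.
apply: (bddm_ln (expR_gt0 (- M))) => [y|].
  apply: mean_ge => [|x]; first exact/bddm_expR/bddm_cost.
  by rewrite ler_expR lerNl (le_trans (ler_norm _))// normrN (hM (x, y)).
(* Only the regularity in [y] of the inner integral is wanted here; the Dirac mass merely supplies
   some probability on the second factor. *)
have [] // := mean_fubini mu (dirac (point : T2) : probability T2 R) (bddm_expR bh).
Qed.

Let osc_arith (r s C : R) : r - C - s <= r - r -> r - s <= C.
Proof. lra. Qed.

Let jensen_arith (r s m : R) : m <= r - s -> s - r <= - m.
Proof. lra. Qed.

Let midpoint_arith (r s u v w : R) : (u + v) / 2 <= w ->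
  (r + s) / 2 - w <= (r - u + (s - v)) / 2.
Proof. lra. Qed.

(** The kernel at [y'] with constant [TX phi y - C] is dominated by the normalised kernel at [y], so
    its integral is at most [1]. *)
Lemma transformX_osc phi (C : R) y y' : bddm phi ->
  (forall x, c x y - c x y' <= C) -> TX phi y - TX phi y' <= C.
Proof.
move=> bphi cC.
have : \int[mu]_x expR ((phi x + (TX phi y - C) - c x y') / lambda) <=
    \int[mu]_x expR ((phi x + TX phi y - c x y) / lambda).
  apply: le_mean; [exact/bddm_expR/bddm_kernel..|].
  by move=> x; rewrite ler_expR ler_pM2r ?invr_gt0//; have := cC x; lra.
by rewrite !transformX_kernel// ler_expR ler_pM2r ?invr_gt0//; exact: osc_arith.
Qed.

(** [TX] is concave in the potential, and this is its tangent at [phi]. It is Jensen's inequality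
    for the exponential under the normalised kernel [k], proved from the tangent to the exponential
    at [m / lambda]. *)
Lemma transformX_jensen phi phi' y : bddm phi -> bddm phi' ->
  TX phi' y - TX phi y <= - \int[mu]_x
    ((phi' x - phi x) * expR ((phi x + TX phi y - c x y) / lambda)).
Proof.
move=> bphi bphi'.
pose k x := expR ((phi x + TX phi y - c x y) / lambda).
have bk : bddm k by exact/bddm_expR/bddm_kernel.
have k1 : \int[mu]_x k x = 1 by rewrite transformX_kernel// subrr mul0r expR0.
rewrite -/(k _); set m := Rintegral _ _ _.
have bu : bddm (fun x => (phi' x - phi x) * k x).
  by apply: bddmM => //; exact: bddmB.
have bi : bddm (fun x => lambda^-1 * ((phi' x - phi x) * k x) +
    (1 - m / lambda) * k x).
  by apply: bddmD; apply: bddmM => //; exact: bddm_cst.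
have : expR (m / lambda) <= expR ((TX phi y - TX phi' y) / lambda).
  rewrite -transformX_kernel//.
  have -> : expR (m / lambda) = \int[mu]_x (expR (m / lambda) *
      (lambda^-1 * ((phi' x - phi x) * k x) + (1 - m / lambda) * k x)).
    rewrite meanZ// meanD; [|by apply: bddmM => //; exact: bddm_cst..].
    rewrite !meanZ// k1 (_ : Rintegral _ _ _ = m)//.
    by rewrite mulr1 (mulrC _ m) addrC subrK mulr1.
  apply: le_mean.
  - by apply: bddmM => //; exact: bddm_cst.
  - exact/bddm_expR/bddm_kernel.
  move=> x; rewrite mulrA -mulrDl mulrA.
  have -> : expR ((phi' x + TX phi y - c x y) / lambda) =
      expR (m / lambda) * expR ((phi' x - phi x - m) / lambda) * k x.
    by rewrite -!expRD; congr expR; field; rewrite gt_eqF.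
  rewrite ler_pM2r ?expR_gt0// ler_pM2l ?expR_gt0//.
  apply: le_trans (expR_ge1Dx _).
  by rewrite mulrBl (mulrC lambda^-1) addrC -addrA lerD2l addrC.
by rewrite ler_expR ler_pM2r ?invr_gt0//; exact: jensen_arith.
Qed.

(** Joint concavity in potential and point, from Cauchy-Schwarz. It serves twice: with [y = y' = z],
    and, for the linear cost, with [z] the midpoint of [y] and [y']. *)
Lemma transformX_midpoint phi phi' y y' z : bddm phi -> bddm phi' ->
  (forall x, (c x y + c x y') / 2 <= c x z) ->
  (TX phi y + TX phi' y') / 2 <= TX (fun x => (phi x + phi' x) / 2) z.
Proof.
move=> bphi bphi' cz.
have bm : bddm (fun x => (phi x + phi' x) / 2).
  by apply: bddmM; [exact: bddmD|exact: bddm_cst].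
have := @ln_mean_expR_midpoint _ _ _ mu _ _ _ (bddm_cost y bphi)
  (bddm_cost y' bphi') (bddm_cost z bm).
rewrite /transformX => h.
rewrite -mulrDr -mulrA !mulNr lerN2 ler_pM2l// h// => x.
by rewrite -mulrDl mulrAC ler_pM2r ?invr_gt0//; exact: midpoint_arith.
Qed.

End transform.

(** * The dual functional and its partial maximisation *)

Section dual.
Context {R : realType} {d1 d2 : measure_display}.
Context {T1 : measurableType d1} {T2 : measurableType d2}.
Variables (mu : probability T1 R) (nu : probability T2 R).
Variables (c : T1 -> T2 -> R) (lambda : R).
Hypothesis lambda0 : 0 < lambda.
Hypothesis bc : bddm (fun z : T1 * T2 => c z.1 z.2).
Implicit Types (phi : T1 -> R) (psi : T2 -> R).

Local Notation F := (dual_fun mu nu c lambda).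
Local Notation TX := (transformX mu c lambda).
Local Notation TY := (transformY nu c lambda).

(** [TY] is [TX] for the cost with swapped arguments, so its properties are inherited once the
    swapped cost is known to be bounded. *)
Lemma bddm_swap : bddm (fun z : T2 * T1 => c z.2 z.1).
Proof. exact: (bddm_comp (@measurable_swap _ _ T2 T1) bc). Qed.

Lemma bddm_transformY psi : bddm psi -> bddm (TY psi).
Proof. exact: (bddm_transformX nu (c := fun y x => c x y) lambda bddm_swap). Qed.

Lemma bddm_plan phi psi : bddm phi -> bddm psi ->
  bddm (fun z : T1 * T2 => expR ((phi z.1 + psi z.2 - c z.1 z.2) / lambda)).
Proof.
move=> bphi bpsi; apply/bddm_expR/bddmM; last exact: bddm_cst.
by apply: bddmB => //; apply: bddmD; [exact: bddm_fst|exact: bddm_snd].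
Qed.

Lemma transformY_kernel psi (r : R) x : bddm psi ->
  \int[nu]_y expR ((r + psi y - c x y) / lambda) =
  expR ((r - TY psi x) / lambda).
Proof.
move=> bpsi.
rewrite -(transformX_kernel nu (c := fun y x => c x y) lambda0 bddm_swap)//.
by apply: eq_Rintegral => y _; rewrite (addrC r).
Qed.

Lemma dual_funX phi psi : bddm phi -> bddm psi ->
  F phi psi = \int[mu]_x phi x + \int[nu]_y psi y +
    lambda * (1 - \int[nu]_y expR ((psi y - TX phi y) / lambda)).
Proof.
move=> bphi bpsi; rewrite /dual_fun; congr (_ + _ * (_ - _)).
by apply: eq_Rintegral => y _; exact: transformX_kernel.
Qed.

Lemma dual_funY phi psi : bddm phi -> bddm psi ->
  F phi psi = \int[mu]_x phi x + \int[nu]_y psi y +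
    lambda * (1 - \int[mu]_x expR ((phi x - TY psi x) / lambda)).
Proof.
move=> bphi bpsi; rewrite /dual_fun; congr (_ + _ * (_ - _)).
have [_ _ /= ->] := mean_fubini mu nu (bddm_plan bphi bpsi).
by apply: eq_Rintegral => x _ /=; exact: transformY_kernel.
Qed.

(** The kernel of [(phi, TX phi)] has total mass [1], so the penalty term vanishes. *)
Lemma dual_fun_transformX phi : bddm phi ->
  F phi (TX phi) = \int[mu]_x phi x + \int[nu]_y TX phi y.
Proof.
move=> bphi; rewrite dual_funX//; last exact: bddm_transformX.
under [X in 1 - X]eq_Rintegral do rewrite subrr mul0r expR0.
by rewrite mean_cst subrr mulr0 addr0.
Qed.

Lemma dual_fun_transformY psi : bddm psi ->
  F (TY psi) psi = \int[mu]_x TY psi x + \int[nu]_y psi y.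
Proof.
move=> bpsi; rewrite dual_funY//; last exact: bddm_transformY.
under [X in 1 - X]eq_Rintegral do rewrite subrr mul0r expR0.
by rewrite mean_cst subrr mulr0 addr0.
Qed.

(** Integrate [1 + z <= expR z] at [z = (f x - g x) / lambda]. With [g] a transform, this says that
    each half-step maximises the dual functional in one variable. *)
Let ascent (d : measure_display) (S : measurableType d)
    (P : probability S R) (f g : S -> R) : bddm f -> bddm g ->
  \int[P]_x f x + lambda * (1 - \int[P]_x expR ((f x - g x) / lambda)) <=
  \int[P]_x g x.
Proof.
move=> bf bg.
have bz : bddm (fun x => (f x - g x) / lambda).
  by apply: bddmM; [exact: bddmB|exact: bddm_cst].
have : \int[P]_x (1 + (f x - g x) / lambda) <=
    \int[P]_x expR ((f x - g x) / lambda).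
  apply: le_mean => [||x]; [|exact: bddm_expR|exact: expR_ge1Dx].
  by apply: bddmD => //; exact: bddm_cst.
rewrite meanD//; last exact: bddm_cst.
rewrite mean_cst meanZr ?meanB//; last exact: bddmB.
rewrite -(ler_pM2l lambda0) mulrDr mulrCA divff ?gt_eqF// !mulr1; lra.
Qed.

Lemma dual_fun_leX phi psi : bddm phi -> bddm psi -> F phi psi <= F phi (TX phi).
Proof.
move=> bphi bpsi; rewrite dual_fun_transformX// dual_funX// -addrA lerD2l.
by apply: ascent => //; exact: bddm_transformX.
Qed.

Lemma dual_fun_leY phi psi : bddm phi -> bddm psi -> F phi psi <= F (TY psi) psi.
Proof.
move=> bphi bpsi; rewrite dual_fun_transformY// dual_funY// addrAC lerD2r.
by apply: ascent => //; exact: bddm_transformY.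
Qed.

End dual.

(** * Variance bounds *)

Section exponential_estimates.
Context {R : realType}.
Implicit Types s t z q : R.

(** The bound [expR (1 / 4) <= 4 / 3] comes from [3 / 4 <= expR (- (1 / 4))]. The value [11 / 2]
    produces the constant [44 = 8 * (11 / 2)] of the variance bound. *)
Lemma expR_5div4_le : expR (5 / 4) <= 11 / 2 :> R.
Proof.
have e4 : expR (1 / 4) <= 4 / 3 :> R.
  have := expR_ge1Dx (- (1 / 4) : R); rewrite expRN.
  have := expR_gt0 (1 / 4 : R); move: (expR _) => e e0.
  rewrite -(ler_pM2l e0) divff ?gt_eqF//; lra.
rewrite (_ : 5 / 4 = 1 / 4 * 5%:R); last by field.
rewrite expRM_natr (@le_trans _ _ ((4 / 3) ^+ 5))//; last by lra.
by rewrite lerXn2r ?nnegrE ?expR_ge0//; lra.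
Qed.

(** Beyond [m] the exponential has slope at least [expR m]; for [t <= s] this is read off from the
    tangent at [t]. *)
Lemma sqr_expRB_ge (m : R) s t : m <= s -> m <= t ->
  expR (2 * m) * (s - t) ^+ 2 <= (expR s - expR t) ^+ 2.
Proof.
wlog ts : s t / t <= s => [hw ms mt|_ mt].
  have [ts|/ltW st] := leP t s; first exact: hw.
  by rewrite -(sqrrN (s - t)) -(sqrrN (expR s - _)) !opprB; exact: hw.
rewrite mulrC expRM_natl -exprMn mulrC lerXn2r ?nnegrE//.
- by rewrite mulr_ge0 ?expR_ge0// subr_ge0.
- by rewrite subr_ge0 ler_expR.
rewrite (@le_trans _ _ (expR t * (s - t)))//.
  by rewrite ler_wpM2r ?subr_ge0// ler_expR.
rewrite -[in leRHS](subrK t s) expRD mulrC.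
have := expR_ge1Dx (s - t); have := expR_gt0 t.
by move: (expR (s - t)) (expR t) (s - t) => a b r b0 ar; nra.
Qed.

(** This is [ln (1 + z) >= z - z ^+ 2]. With [r = z ^+ 2 - z], the inverse form
    [(1 + z)^-1 <= expR r] is obtained from [(1 + r / 2) ^+ 2 <= expR r], because [1 + r] is too
    small for negative [z]. *)
Lemma expRB_sqr_le z : `|z| <= 1 / 4 -> expR (z - z ^+ 2) <= 1 + z.
Proof.
rewrite ler_norml => /andP[z1 z2].
have z0 : 0 < 1 + z by lra.
rewrite -[leLHS]invrK -expRN invf_ple ?posrE ?expR_gt0// opprB.
have e2 : (1 + (z ^+ 2 - z) / 2) ^+ 2 <= expR (z ^+ 2 - z).
  rewrite [in leRHS](_ : z ^+ 2 - z = (z ^+ 2 - z) / 2 * 2%:R); last by field.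
  rewrite expRM_natr lerXn2r ?nnegrE ?expR_ge0 ?expR_ge1Dx//; nra.
apply: le_trans e2.
rewrite -[leLHS]mul1r ler_pdivrMr//; nra.
Qed.

(* When [expR (- q)] is a probability density, [expR (- q) - 1 + q] integrates
   to a relative entropy. *)
Lemma entropy_young (A w q : R) : 0 < A -> `|w| <= A / 4 ->
  w * (1 - expR (- q)) <= A * (expR (- q) - 1 + q) + A^-1 * w ^+ 2.
Proof.
move=> A0 wA; pose z := w / A.
have z4 : `|z| <= 1 / 4.
  rewrite normrM [X in _ * X]gtr0_norm ?invr_gt0// ler_pdivrMr//.
  by rewrite mulrC mulrA mulr1.
have -> : w = A * z by rewrite /z; field; rewrite gt_eqF.
have -> : A^-1 * (A * z) ^+ 2 = A * z ^+ 2 by field; rewrite gt_eqF.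
rewrite -mulrA -mulrDr ler_pM2l//.
(* After division by [A] the claim rearranges to this: [1 + r <= expR r] at [r = z - z ^+ 2 - q],
   followed by [expR (z - z ^+ 2) <= 1 + z]. *)
have : 1 + (z - z ^+ 2 - q) <= (1 + z) * expR (- q).
  apply: le_trans (expR_ge1Dx _) _.
  by rewrite expRD ler_pM2r ?expR_gt0// expRB_sqr_le.
by move: (expR _) (z); clear => e y; lra.
Qed.

End exponential_estimates.

(** * Variance against the midpoint concavity gap *)

Section variance.
Context {R : realType} {d : measure_display} {T : measurableType d}.
Variable P : probability T R.
Implicit Types f g : T -> R.

(** Expanding the right-hand side around the mean [m], the cross term integrates to [0] and
    [(m - r) ^+ 2] remains. *)
Lemma variance_le f (r : R) : bddm f ->
  \int[P]_x (f x - \int[P]_x' f x') ^+ 2 <= \int[P]_x (f x - r) ^+ 2.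
Proof.
move=> bf; set m := \int[P]_x' f x'.
have bfm (k : R) : bddm (fun x => f x - k) by apply: bddmB => //; exact: bddm_cst.
have bf2 (k : R) : bddm (fun x => (f x - k) ^+ 2).
  by under eq_fun do rewrite expr2; exact: bddmM.
have -> : \int[P]_x (f x - r) ^+ 2 = \int[P]_x ((f x - m) ^+ 2 +
    ((f x - m) * (2 * (m - r)) + (m - r) ^+ 2)).
  by apply: eq_Rintegral => x _; ring.
have b1 : bddm (fun x => (f x - m) * (2 * (m - r))).
  by apply: bddmM => //; exact: bddm_cst.
rewrite meanD//; last by apply: bddmD => //; exact: bddm_cst.
rewrite meanD//; last exact: bddm_cst.
rewrite meanZr// meanB//; last exact: bddm_cst.
by rewrite !mean_cst -/m subrr mul0r add0r lerDl sqr_ge0.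
Qed.

Lemma osc_mean f (C : R) x : bddm f -> (forall x x', f x - f x' <= C) ->
  `|f x - \int[P]_x' f x'| <= C.
Proof.
move=> bf fC; rewrite ler_norml; apply/andP; split.
  have : \int[P]_x' f x' <= f x + C by apply: mean_le => // x'; have := fC x' x; lra.
  lra.
have : f x - C <= \int[P]_x' f x' by apply: mean_ge => // x'; have := fC x x'; lra.
lra.
Qed.

Lemma bddm_sqr f : bddm f -> bddm (fun x => f x ^+ 2).
Proof. by move=> bf; under eq_fun do rewrite expr2; exact: bddmM. Qed.

(** The mean [1] of the exponentials cannot exceed their upper bound [expR (f x + r)]. *)
Lemma expR_mean1_ge f (r : R) : bddm f -> (forall x x', f x - f x' <= r) ->
  \int[P]_x expR (f x) = 1 -> forall x, - r <= f x.
Proof.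
move=> bf fr f1 x; have : \int[P]_x' expR (f x') <= expR (f x + r).
  apply: mean_le => [|x']; first exact: bddm_expR.
  by rewrite ler_expR; have := fr x' x; clear; lra.
by rewrite f1 -expR0 ler_expR; clear; lra.
Qed.

Lemma expR_mean1_le0 f : bddm f -> \int[P]_x expR (f x) = 1 ->
  \int[P]_x f x <= 0.
Proof.
move=> bf f1; have : \int[P]_x (1 + f x) <= \int[P]_x expR (f x).
  apply: le_mean => [||x]; [|exact: bddm_expR|exact: expR_ge1Dx].
  by apply: bddmD => //; exact: bddm_cst.
by rewrite f1 meanD// ?mean_cst ?gerDl//; exact: bddm_cst.
Qed.

Let gap_arith (E r g v : R) : 0 < E -> 0 <= g -> r <= 11 / 2 ->
  1 <= E * r * g + (2^-1 * (1 + 1) - E / 8 * v) -> v <= 44 * g.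
Proof.
move=> E0 g0 r5 ineq.
have : E / 8 * v <= E / 8 * (8 * r * g) by move: ineq; clear; lra.
rewrite ler_pM2l ?divr_gt0// => /le_trans; apply.
by rewrite ler_wpM2r//; lra.
Qed.

(* Both sides compare the Hellinger affinity of the densities [expR (p x)] and
   [expR (q x)] with [1]. *)
Lemma normalised_midpoint_gap (p q k : T -> R) : bddm p -> bddm q -> bddm k ->
  (forall x x', p x - p x' <= 1 / 2) -> (forall x x', q x - q x' <= 1 / 2) ->
  (forall x x', k x - k x' <= 1 / 2) -> (forall x, (p x + q x) / 2 <= k x) ->
  \int[P]_x expR (p x) = 1 -> \int[P]_x expR (q x) = 1 ->
  1 <= \int[P]_x expR (k x) ->
  \int[P]_x (k x - (p x + q x) / 2) <= 1 / 4 ->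
  \int[P]_x (q x - p x) ^+ 2 <= 44 * \int[P]_x (k x - (p x + q x) / 2).
Proof.
move=> bp bq bk po qo ko pqk p1 q1 k1.
pose G x := k x - (p x + q x) / 2; rewrite -/(G _).
have bpq : bddm (fun x => (p x + q x) / 2).
  by apply: bddmM; [exact: bddmD|exact: bddm_cst].
have bG : bddm G by exact: bddmB.
have G0 x : 0 <= G x by rewrite subr_ge0.
rewrite (_ : Rintegral _ _ _ = \int[P]_x G x)// => G4.
have phalf := expR_mean1_ge bp po p1.
have qhalf := expR_mean1_ge bq qo q1.
(* By Jensen's inequality the normalised [p] and [q] have nonpositive means, so the mean of [k] is
   at most that of [G]. With oscillation at most [1 / 2], this bounds [k] by [3 / 4] everywhere. *)
have mk : \int[P]_x k x <= 1 / 4.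
  have -> : \int[P]_x k x =
      \int[P]_x G x + (\int[P]_x p x + \int[P]_x q x) / 2.
    rewrite meanB// meanZr; last exact: bddmD.
    by rewrite meanD// subrK.
  have := expR_mean1_le0 bp p1; have := expR_mean1_le0 bq q1.
  by move: G4; clear; lra.
have k34 x : k x <= 3 / 4.
  have := osc_mean x bk ko.
  by rewrite ler_norml => /andP[_]; move: mk; clear; lra.
pose e := expR (3 / 4) : R; pose e' := expR (- (1 / 2)) : R.
(* Passing from [(p x + q x) / 2] to [k x] costs at most [e * G x]. At the midpoint, the exponential
   falls below the arithmetic mean by half the square of [expR (q x / 2) - expR (p x / 2)], and both
   exponents are at least [- (1 / 4)]. *)
have pointwise x : expR (k x) <=
    e * G x + (2^-1 * (expR (p x) + expR (q x)) - e' / 8 * (q x - p x) ^+ 2).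
  have h1 : expR (k x) - expR ((p x + q x) / 2) <= e * G x.
    have -> : (p x + q x) / 2 = k x - G x by rewrite subKr.
    apply: (@le_trans _ _ (expR (k x) * G x)); last first.
      by rewrite ler_wpM2r// ler_expR.
    rewrite expRD; have := expR_ge1Dx (- G x); have := expR_gt0 (k x).
    by move: (G x) (expR (- _)) (expR (k x)) => t s r; clear; nra.
  have h2 : e' * (q x / 2 - p x / 2) ^+ 2 <=
      (expR (q x / 2) - expR (p x / 2)) ^+ 2.
    rewrite /e' (_ : - (1 / 2) = 2 * (- (1 / 4))); last by field.
    by apply: sqr_expRB_ge;
      [have := qhalf x|have := phalf x]; clear; lra.
  have dbl (r : R) : expR r = expR (r / 2) ^+ 2 by rewrite -expRM_natr divfK.
  move: h1 h2; rewrite (dbl (p x)) (dbl (q x)) mulrDl expRD.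
  move: (q x) (p x) (G x) (expR (q x / 2)) (expR (p x / 2)) (expR (k x)).
  move: (e) (e'); clear => E E' q p g s r K.
  by rewrite -mulrBl expr_div_n; lra.
have be2 : bddm (fun x => 2^-1 * (expR (p x) + expR (q x))).
  by apply: bddmM; [exact: bddm_cst|by apply: bddmD; exact: bddm_expR].
have bd : bddm (fun x => (q x - p x) ^+ 2) by exact/bddm_sqr/bddmB.
have bd2 : bddm (fun x => e' / 8 * (q x - p x) ^+ 2).
  by apply: bddmM => //; exact: bddm_cst.
have beG : bddm (fun x => e * G x) by apply: bddmM => //; exact: bddm_cst.
have := le_mean P (bddm_expR bk) (bddmD beG (bddmB be2 bd2)) pointwise.
rewrite meanD//; last exact: bddmB.
rewrite meanB// !meanZ//; last by apply: bddmD; exact: bddm_expR.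
rewrite meanD; [|exact: bddm_expR..].
rewrite p1 q1 => /(le_trans k1).
(* The total masses cancel, leaving [e' / 8] times the integrated square below [e] times the gap;
   only the ratio of [e] and [e'] matters. *)
have ee : e = e' * expR (5 / 4) by rewrite -expRD; congr expR; field.
have e'0 : 0 < e' by exact: expR_gt0.
have mG0 : 0 <= \int[P]_x G x by exact: Rintegral_ge0.
by rewrite ee; apply: gap_arith => //; exact: expR_5div4_le.
Qed.

(* The normalisation uses [a = (2 C)^-1], so that all oscillations become at
   most [1 / 2]. *)
Lemma variance_le_midpoint_gap f g h (C : R) : 0 < C ->
  bddm f -> bddm g -> bddm h ->
  (forall x x', f x - f x' <= C) -> (forall x x', g x - g x' <= C) ->
  (forall x x', h x - h x' <= C) ->
  (forall x, (f x + g x) / 2 <= h x) ->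
  (\int[P]_x expR (f x / (2 * C))) * (\int[P]_x expR (g x / (2 * C))) <=
    (\int[P]_x expR (h x / (2 * C))) ^+ 2 ->
  \int[P]_x (g x - f x - \int[P]_x' (g x' - f x')) ^+ 2 <=
    88 * C * (\int[P]_x h x - (\int[P]_x f x + \int[P]_x g x) / 2).
Proof.
move=> C0 bf bg bh fC gC hC fgh pl.
have bgf : bddm (fun x => g x - f x) by exact: bddmB.
set EG := \int[P]_x h x - _.
(* For a large gap the trivial bound suffices: [g - f] oscillates by at most [2 * C], so its
   variance is at most [4 * C ^+ 2]. Otherwise the rescaled gap is at most [1 / 4], as the
   normalised statement requires. *)
have [EGC|EGC] := leP (C / 2) EG.
  apply: (@le_trans _ _ (4 * C ^+ 2)); last first.
    by move: (EG) (C) C0 EGC; clear => g D D0 gD; nra.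
  apply: mean_le => [|x].
    by apply: bddm_sqr; apply: bddmB => //; exact: bddm_cst.
  have gf2 x1 x2 : g x1 - f x1 - (g x2 - f x2) <= 2 * C.
    by have := gC x1 x2; have := fC x2 x1; clear; lra.
  have := osc_mean x bgf gf2; rewrite ler_norml => /andP[].
  by move: (C) C0 (_ - Rintegral _ _ _); clear => D D0 r *; nra.
pose a := (2 * C)^-1; have a0 : 0 < a by rewrite invr_gt0 mulr_gt0.
have aC : C / (2 * C) = 1 / 2 by field; rewrite gt_eqF.
have ba (k : T -> R) : bddm k -> bddm (fun x => k x / (2 * C)).
  by move=> bk; apply: bddmM => //; exact: bddm_cst.
have bi (k : T -> R) (r : R) : bddm k -> bddm (fun x => k x / (2 * C) - r).
  by move=> bk; apply: bddmB; [exact: ba|exact: bddm_cst].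
have lnE (k : T -> R) : bddm k -> \int[P]_x expR (k x / (2 * C)) =
    expR (ln (\int[P]_x expR (k x / (2 * C)))).
  by move=> bk; rewrite lnK// posrE; apply: mean_expR_gt0; exact: ba.
have shiftE (k : T -> R) (r : R) : bddm k -> \int[P]_x expR (k x / (2 * C) - r) =
    (\int[P]_x expR (k x / (2 * C))) * expR (- r).
  move=> bk; rewrite -meanZr; last exact/bddm_expR/ba.
  by apply: eq_Rintegral => x _; rewrite -expRD.
have oscs (l : T -> R) r : (forall x x', l x - l x' <= C) ->
    forall x x', l x / (2 * C) - r - (l x' / (2 * C) - r) <= 1 / 2.
  move=> lC x x'; rewrite -aC opprB addrA subrK -mulrBl.
  by rewrite ler_pM2r.
have := lnE _ bf; have := lnE _ bg.
(* [A] and [B] normalise the exponentials of [f] and [g]. Shifting [h] by [(A + B) / 2] preserves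
   the midpoint inequality, and [pl] then says that its exponential has mean at least [1]. *)
move: (ln _) (ln _) => A B eB eA.
have GE x : h x / (2 * C) - (A + B) / 2 -
    (f x / (2 * C) - A + (g x / (2 * C) - B)) / 2 =
    a * (h x - (f x + g x) / 2).
  by rewrite /a; field; rewrite gt_eqF.
have bfg : bddm (fun x => (f x + g x) / 2).
  by apply: bddmM; [exact: bddmD|exact: bddm_cst].
have mG : \int[P]_x (h x / (2 * C) - (A + B) / 2 -
    (f x / (2 * C) - A + (g x / (2 * C) - B)) / 2) = a * EG.
  under eq_Rintegral do rewrite GE.
  rewrite meanZ; last exact: bddmB.
  by rewrite meanB// meanZr ?meanD//; exact: bddmD.
have aEG4 : a * EG <= 1 / 4.
  rewrite (_ : 1 / 4 = a * (C / 2)) ?ler_pM2l// ?ltW//.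
  by rewrite /a; field; rewrite gt_eqF.
have := @normalised_midpoint_gap _ _ _ (bi f A bf) (bi g B bg)
  (bi h ((A + B) / 2) bh) (oscs _ _ fC) (oscs _ _ gC) (oscs _ _ hC).
have mean1 (k : T -> R) (r : R) : bddm k ->
    \int[P]_x expR (k x / (2 * C)) = expR r ->
    \int[P]_x expR (k x / (2 * C) - r) = 1.
  by move=> bk kr; rewrite shiftE// kr -expRD subrr expR0.
rewrite mG => V44.
have {}V44 : \int[P]_x (g x / (2 * C) - B - (f x / (2 * C) - A)) ^+ 2 <=
    44 * (a * EG).
  apply: V44 => //; [|exact: (mean1 f A bf eA)|exact: (mean1 g B bg eB)|].
    by move=> x; rewrite -subr_ge0 GE mulr_ge0 ?(ltW a0)// subr_ge0.
  rewrite shiftE// expRN ler_pdivlMr ?expR_gt0// mul1r.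
  have := mean_expR_gt0 P (ba _ bh); move: pl; rewrite eA eB.
  move: (Rintegral _ _ _) => I pl I0.
  rewrite -(@ler_pXn2r _ 2%N) ?nnegrE ?expR_ge0 ?(ltW I0)//.
  by rewrite -expRM_natr divfK// expRD.
(* The normalised potentials differ by [a] times [g - f] recentred at this constant, which need not
   be the mean. *)
have := variance_le ((B - A) * (2 * C)) bgf => /le_trans; apply.
rewrite -(ler_pM2l (exprn_gt0 2 a0)) -meanZ; last first.
  by apply: bddm_sqr; apply: bddmB => //; exact: bddm_cst.
rewrite (_ : a ^+ 2 * _ = 44 * (a * EG)); last first.
  by rewrite /a; field; rewrite gt_eqF.
apply: le_trans V44; rewrite le_eqVlt; apply/orP; left; apply/eqP.
apply: eq_Rintegral => x _; rewrite -exprMn; congr (_ ^+ 2).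
by rewrite /a; field; rewrite gt_eqF.
Qed.

End variance.

(** * One step of Sinkhorn's algorithm *)

Section contraction.
Context {R : realType} {d1 d2 : measure_display}.
Context {T1 : measurableType d1} {T2 : measurableType d2}.
Variables (mu : probability T1 R) (nu : probability T2 R).
Variables (c : T1 -> T2 -> R) (lambda : R).
Hypothesis lambda0 : 0 < lambda.
Hypothesis bc : bddm (fun z : T1 * T2 => c z.1 z.2).
Implicit Types (phi : T1 -> R) (psi : T2 -> R).

Local Notation F := (dual_fun mu nu c lambda).
Local Notation TX := (transformX mu c lambda).
Local Notation TY := (transformY nu c lambda).

(* The density with respect to [mu] of the first marginal of the coupling
   associated with [(phi, TX phi)]. *)
Let marginal phi x := expR (- ((TY (TX phi) x - phi x) / lambda)).

Let bddm_marginal phi : bddm phi -> bddm (marginal phi).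
Proof.
move=> bphi; apply/bddm_expR/bddmN/bddmM; last exact: bddm_cst.
apply: bddmB => //; apply: (bddm_transformY nu lambda bc).
exact: (bddm_transformX mu lambda bc).
Qed.

Let mean_marginal phi phi' : bddm phi -> bddm phi' ->
  \int[nu]_y \int[mu]_x
    (phi' x * expR ((phi x + TX phi y - c x y) / lambda)) =
  \int[mu]_x (phi' x * marginal phi x).
Proof.
move=> bphi bphi'; have bT := bddm_transformX mu lambda bc bphi.
have bk := bddm_plan lambda bc bphi bT.
have bh : bddm (fun z : T1 * T2 =>
    phi' z.1 * expR ((phi z.1 + TX phi z.2 - c z.1 z.2) / lambda)).
  by apply: bddmM => //; exact: bddm_fst.
have [_ _ /= ->] := mean_fubini mu nu bh.
apply: eq_Rintegral => x _.
rewrite meanZ; last exact: (bddm_section2 x bk).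
rewrite (transformY_kernel nu lambda0 bc)// /marginal; congr (_ * expR _).
by rewrite -[in LHS]opprB mulNr.
Qed.

(** The second marginal of the coupling is [nu]: integrating over [x] first gives [1] for every
    [y]. *)
Let mean_marginal1 phi : bddm phi -> \int[mu]_x marginal phi x = 1.
Proof.
move=> bphi; rewrite -[RHS](mean_cst nu 1).
transitivity (\int[mu]_x (1 * marginal phi x)).
  by apply: eq_Rintegral => x _; rewrite mul1r.
rewrite -mean_marginal//; last exact: bddm_cst.
apply: eq_Rintegral => y _.
under eq_Rintegral do rewrite mul1r.
by rewrite (transformX_kernel mu lambda0 bc)// subrr mul0r expR0.
Qed.

Let tangent_arith (r1 r2 s1 s2 k : R) : s1 - s2 <= - k ->
  r1 + s1 - (r2 + s2) <= r1 - r2 - k.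
Proof. lra. Qed.

(** The semi-dual [phi |-> F phi (TX phi)] is concave, with gradient [1 - marginal phi] with respect
    to [mu]; the pointwise tangent inequality is integrated over [nu]. *)
Lemma dual_fun_tangent phi phi' : bddm phi -> bddm phi' ->
  F phi' (TX phi') - F phi (TX phi) <=
  \int[mu]_x ((phi' x - phi x) * (1 - marginal phi x)).
Proof.
move=> bphi bphi'; have bT := bddm_transformX mu lambda bc bphi.
have bT' := bddm_transformX mu lambda bc bphi'.
rewrite (dual_fun_transformX mu nu lambda0 bc bphi).
rewrite (dual_fun_transformX mu nu lambda0 bc bphi').
have bu : bddm (fun x => phi' x - phi x) by exact: bddmB.
have bm := bddm_marginal bphi.
have -> : \int[mu]_x ((phi' x - phi x) * (1 - marginal phi x)) =
    \int[mu]_x phi' x - \int[mu]_x phi x -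
    \int[mu]_x ((phi' x - phi x) * marginal phi x).
  rewrite -meanB// -meanB//; last exact: bddmM.
  by apply: eq_Rintegral => x _; rewrite mulrBr mulr1.
rewrite -mean_marginal//.
have bk := bddm_plan lambda bc bphi bT.
have bh : bddm (fun z : T1 * T2 => (phi' z.1 - phi z.1) *
    expR ((phi z.1 + TX phi z.2 - c z.1 z.2) / lambda)).
  by apply: bddmM => //; exact: (bddm_fst bu).
have [bI _ _] := mean_fubini mu nu bh.
have := le_mean nu (bddmB bT' bT) (bddmN bI)
  (fun y => transformX_jensen mu lambda0 bc y bphi bphi').
rewrite meanB// meanN//; exact: tangent_arith.
Qed.

(* For a log-concave [mu] and the linear cost, [prekopa] holds because
   [TY psi x] is jointly midpoint concave in [psi] and [x]. *)
Variable C : R.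
Hypothesis lambdaC : lambda <= C.
Hypothesis oscX : forall x x' y, c x y - c x' y <= C.
Hypothesis prekopa : forall psi psi', bddm psi -> bddm psi' ->
  (\int[mu]_x expR (TY psi x / (2 * C))) *
    (\int[mu]_x expR (TY psi' x / (2 * C))) <=
  (\int[mu]_x expR (TY (fun y => (psi y + psi' y) / 2) x / (2 * C))) ^+ 2.

Let C0 : 0 < C. Proof. exact: lt_le_trans lambdaC. Qed.

Let oscTY psi x x' : bddm psi -> TY psi x - TY psi x' <= C.
Proof.
move=> bpsi.
exact: (transformX_osc nu (c := fun y x => c x y) lambda0 (bddm_swap bc)).
Qed.

Let gap_arith (S r r1 r2 s s1 s2 f f1 f2 : R) : f <= S -> f = r + s ->
  f1 = r1 + s1 -> f2 = r2 + s2 -> s = (s1 + s2) / 2 ->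
  r - (r1 + r2) / 2 <= S - (f1 + f2) / 2.
Proof. by move=> fS fE -> -> sE; rewrite fE sE in fS; lra. Qed.

(** The dual value at the midpoint of [psi] and [psi'] is at most [S]. There the means of the
    [nu]-potentials average exactly, so the right-hand side dominates the midpoint gap of the
    transforms. *)
Let variance_le_gap psi psi' (S : R) : bddm psi -> bddm psi' ->
  (forall phi psi, bddm phi -> bddm psi -> F phi psi <= S) ->
  \int[mu]_x (TY psi' x - TY psi x -
      \int[mu]_x' (TY psi' x' - TY psi x')) ^+ 2 <=
  88 * C * (S - (F (TY psi) psi + F (TY psi') psi') / 2).
Proof.
move=> bpsi bpsi' FS.
have bT := bddm_transformY nu lambda bc bpsi.
have bT' := bddm_transformY nu lambda bc bpsi'.
have bm : bddm (fun y => (psi y + psi' y) / 2).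
  by apply: bddmM; [exact: bddmD|exact: bddm_cst].
have bTm := bddm_transformY nu lambda bc bm.
have mid x : (TY psi x + TY psi' x) / 2 <=
    TY (fun y => (psi y + psi' y) / 2) x.
  apply: (transformX_midpoint nu (c := fun y x => c x y) lambda0
    (bddm_swap bc)) => // y.
  lra.
have := variance_le_midpoint_gap C0 bT bT' bTm
  (fun x x' => oscTY x x' bpsi) (fun x x' => oscTY x x' bpsi')
  (fun x x' => oscTY x x' bm) mid (prekopa bpsi bpsi').
move=> /le_trans; apply; rewrite ler_wpM2l//; first by rewrite mulr_ge0// ltW.
apply: (gap_arith (FS _ _ bTm bm)
  (dual_fun_transformY mu nu lambda0 bc bm)
  (dual_fun_transformY mu nu lambda0 bc bpsi)
  (dual_fun_transformY mu nu lambda0 bc bpsi')).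
by rewrite meanZr ?meanD//; exact: bddmD.
Qed.

Let small_arith (r : R) : r <= 2 * C -> r <= 88 * C / 4.
Proof. by move=> rC; have := C0; lra. Qed.

Let osc_arith (a b a' b' : R) : a - b <= C -> b' - a' <= C ->
  a - a' - (b - b') <= 2 * C.
Proof. lra. Qed.

Let sub_arith (r s k f g : R) : f = r + k -> g = s + k -> r - s = f - g.
Proof. by move=> -> ->; rewrite opprD addrACA subrr addr0. Qed.

(** The term [v] is at most [(S - e0) / 2 + e / 6]. Absorbing half of the gap doubles [88] into
    [176], and the errors add up to [2 * (e / 3 + e / 6) = e]. The increment [eh - e0] is covered
    because [88 * K >= 1]. *)
Let step_arith (K e v S e0 eh e1 s0 s1 : R) :
  1 <= K -> 0 <= e -> e0 <= eh -> eh <= e1 -> s0 <= s1 -> S - e / 3 < s0 ->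
  v <= S - (e0 + s0) / 2 -> s1 - eh <= 88 * K * (e1 - eh) + v ->
  S - e0 <= 176 * K * (e1 - e0) + e.
Proof.
move=> K1 e_ge0 h1 h2 h3 h4 h5 h6.
have : 0 <= (K - 1) * (eh - e0) by rewrite mulr_ge0// subr_ge0.
lra.
Qed.

Lemma sinkhorn_step psi (S : R) : bddm psi ->
  (forall phi psi, bddm phi -> bddm psi -> F phi psi <= S) ->
  (forall e, 0 < e ->
    exists phi psi, [/\ bddm phi, bddm psi & S - e < F phi psi]) ->
  S - F (TY psi) psi <= 176 * (C / lambda) *
    (F (TY (TX (TY psi))) (TX (TY psi)) - F (TY psi) psi).
Proof.
(* The supremum may not be attained, so [psi'] is optimal only up to [e / 3], and [e] is
   arbitrary. *)
move=> bpsi FS FSe; apply/ler_addgt0Pr => e e0.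
have e3 : 0 < e / 3 by rewrite divr_gt0.
have [phi1 [psi' [bphi1 bpsi' Se]]] := FSe _ e3.
set phi := TY psi; set phi' := TY psi'.
have bphi : bddm phi := bddm_transformY nu lambda bc bpsi.
have bphi' : bddm phi' := bddm_transformY nu lambda bc bpsi'.
have {}Se : S - e / 3 < F phi' psi'.
  exact: (lt_le_trans Se (dual_fun_leY mu nu lambda0 bc bphi1 bpsi')).
have bTX := bddm_transformX mu lambda bc bphi.
have bTY := bddm_transformY nu lambda bc bTX.
have eh := dual_fun_leX mu nu lambda0 bc bphi bpsi.
have e1 := dual_fun_leY mu nu lambda0 bc bphi bTX.
have es := dual_fun_leX mu nu lambda0 bc bphi' bpsi'.
have tan := dual_fun_tangent bphi bphi'.
have var := variance_le_gap bpsi bpsi' FS.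
have bu : bddm (fun x => phi' x - phi x) by exact: bddmB.
set m := \int[mu]_x (phi' x - phi x) in var.
pose w x := phi' x - phi x - m.
pose q x := (TY (TX phi) x - phi x) / lambda.
have bq : bddm q by apply: bddmM; [exact: bddmB|exact: bddm_cst].
have bp := bddm_marginal bphi.
have bw : bddm w by apply: bddmB => //; exact: bddm_cst.
have ow x1 x2 : phi' x1 - phi x1 - (phi' x2 - phi x2) <= 2 * C.
  exact: (osc_arith (oscTY x1 x2 bpsi') (oscTY x2 x1 bpsi)).
have wC x : `|w x| <= 2 * C by exact: (osc_mean mu x bu ow).
(* Here [A = 88 * C], and the required smallness is [2 * C <= 88 * C / 4]. This [A] cancels the
   factor of the variance bound. *)
have young x : w x * (1 - marginal phi x) <=
    88 * C * (marginal phi x - 1 + q x) + (88 * C)^-1 * w x ^+ 2.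
  by apply: entropy_young; [rewrite mulr_gt0|exact: small_arith].
have ent : \int[mu]_x (w x * (1 - marginal phi x)) <=
    88 * C * \int[mu]_x q x + (88 * C)^-1 * \int[mu]_x w x ^+ 2.
  have b1 : bddm (fun x => marginal phi x - 1 + q x).
    by apply: bddmD => //; apply: bddmB => //; exact: bddm_cst.
  have b2 := bddm_sqr bw.
  apply: (le_trans (le_mean mu _ _ young)).
  - by apply: bddmM => //; apply: bddmB => //; exact: bddm_cst.
  - by apply: bddmD; apply: bddmM => //; exact: bddm_cst.
  rewrite meanD; [|by apply: bddmM => //; exact: bddm_cst..].
  rewrite !meanZ// meanD//; last by apply: bddmB => //; exact: bddm_cst.
  rewrite meanB//; last exact: bddm_cst.
  by rewrite mean_marginal1// mean_cst subrr add0r.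
(* Since [1 - marginal phi] has mean [0], centring [phi' - phi] at [m] leaves the integral
   unchanged. *)
have eqw : \int[mu]_x ((phi' x - phi x) * (1 - marginal phi x)) =
    \int[mu]_x (w x * (1 - marginal phi x)).
  have b1 : bddm (fun x => 1 - marginal phi x).
    by apply: bddmB => //; exact: bddm_cst.
  transitivity (\int[mu]_x (w x * (1 - marginal phi x)) +
      m * \int[mu]_x (1 - marginal phi x)).
    rewrite -meanZ// -meanD; [|exact: bddmM|].
      by apply: eq_Rintegral => x _; rewrite -mulrDl subrK.
    by apply: bddmM => //; exact: bddm_cst.
  rewrite meanB//; last exact: bddm_cst.
  by rewrite mean_marginal1// mean_cst subrr mulr0 addr0.
(* The entropy term is the gain of the half-step from [phi] to [TY (TX phi)], divided by [lambda]:
   the mean of [TX phi] occurs in both dual values and cancels. *)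
have eq1 : \int[mu]_x q x = (F (TY (TX phi)) (TX phi) - F phi (TX phi)) / lambda.
  rewrite meanZr; last exact: bddmB.
  rewrite meanB//; congr (_ / _).
  exact: (sub_arith (dual_fun_transformY mu nu lambda0 bc bTX)
    (dual_fun_transformX mu nu lambda0 bc bphi)).
move: ent; rewrite -eqw => /(le_trans tan); rewrite eq1.
have {}var : (88 * C)^-1 * \int[mu]_x w x ^+ 2 <=
    S - (F phi psi + F phi' psi') / 2.
  by rewrite mulrC ler_pdivrMr ?mulr_gt0// mulrC.
have Cl : 1 <= C / lambda by rewrite ler_pdivlMr// mul1r.
rewrite mulrA mulrAC -(mulrA 88) => final.
exact: (step_arith Cl (ltW e0) eh e1 es Se var final).
Qed.

End contraction.

(** * The Prekopa-Leindler inequality *)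

Section brunn_minkowski.
Context {R : realType}.
Local Notation L := (@lebesgue_measure R).
Local Notation RR := (measurableTypeR R).
Implicit Types A B C D : set RR.

Lemma measurable_midpoint (b : R) :
  measurable_fun [set: RR] (fun x : RR => (x + b) / 2 : RR).
Proof.
by apply: measurable_funM => //; apply: measurable_funD => //.
Qed.

(** Half of the pushforward agrees with Lebesgue measure on the intervals []x, y]], hence on every
    measurable set by uniqueness. *)
Lemma lebesgue_measure_midpoint (b : R) D : measurable D ->
  L ((fun x : RR => (x + b) / 2) @^-1` D) = (2%:E * L D)%E.
Proof.
move=> mD; have h0 : 0 <= 2^-1 :> R by rewrite invr_ge0.
pose p := measure_function_pushforward__canonical__measure_function_Measure
  L (measurable_midpoint b).
pose m := mscale (NngNum h0) p.
rewrite (@lebesgue_measure_unique R m _ D mD).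
  rewrite /m /= /mscale /= /pushforward muleA -EFinM divff// mul1e//.
move=> _ [[x y] /= _ <-]; rewrite /m /mscale /= /pushforward.
rewrite lebesgue_measure_itv/=.
rewrite [X in L X](_ : _ = `](2 * x - b), (2 * y - b)]%classic); last first.
  apply/seteqP; split => z /=; rewrite !in_itv/= => /andP[z1 z2];
    apply/andP; split; lra.
rewrite lebesgue_measure_itv/= !lte_fin ltrD2r ltr_pM2l//.
case: ifP => _; last by rewrite mule0.
by rewrite -!EFinB -EFinM; congr EFin; field.
Qed.

Lemma lebesgue_measure_itv_le (b1 b2 : bool) (x y r : R) : 0 <= r ->
  y - x <= r -> (L [set` Interval (BSide b1 x) (BSide b2 y)] <= r%:E)%E.
Proof.
move=> r0 xyr.
rewrite [leLHS](lebesgue_measure_itv (Interval (BSide b1 x) (BSide b2 y)))/=.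
by case: ifP => _; rewrite ?lee_fin// -EFinB lee_fin.
Qed.

(* [(A cap ]-oo, a]) + b] and [a + (B cap ]b, +oo[)] lie on either side of
   [a + b]; choose [a] close to [sup A] and [b] close to [inf B]. *)
Lemma brunn_minkowski_line A B C (r : R) :
  measurable A -> measurable B -> measurable C ->
  A !=set0 -> B !=set0 -> (forall x, A x -> `|x| <= r) ->
  (forall x, B x -> `|x| <= r) ->
  (forall x y, A x -> B y -> C ((x + y) / 2)) ->
  (L A + L B <= 2%:E * L C)%E.
Proof.
move=> mA mB mC A0 B0 Ar Br ABC; apply/lee_addgt0Pr => e e0.
have e2 : 0 < e / 2 by rewrite divr_gt0.
have hA : has_sup A.
  by split => //; exists r => x /Ar; rewrite ler_norml => /andP[].
have hB : has_inf B.
  by split => //; exists (- r) => x /Br; rewrite ler_norml => /andP[].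
have [a Aa aA] := sup_adherent e2 hA; have [b Bb bB] := inf_adherent e2 hB.
pose m := (a + b) / 2.
(* Points of [A] up to [a] are sent into [C] at or left of [m] by averaging with [b]; the others lie
   in []a, sup A]], of length at most [e / 2]. The mirror argument for [B] uses [C] right of [m], so
   the two parts of [C] are disjoint. *)
have LA : (L A <= 2%:E * L (C `&` `]-oo, m]%classic) + (e / 2)%:E)%E.
  apply: (@le_trans _ _ (L ((fun x : RR => (x + b) / 2) @^-1`
      (C `&` `]-oo, m]%classic) `|` `]a, (sup A)]%classic))).
    apply: le_measure; rewrite ?inE//.
      apply: measurableU; last exact: measurable_itv.
      rewrite -[X in measurable X]setTI; apply: measurable_midpoint => //.
      by apply: measurableI => //; exact: measurable_itv.
    move=> x Ax /=; have xs : x <= sup A by apply: ub_le_sup => //; exact: hA.2.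
    have [xa|ax] := leP x a; last by right; rewrite in_itv/= ax xs.
    by left; split; [exact: ABC|rewrite in_itv/= /m; lra].
  apply: (le_trans (measureU2 _ _ _)).
  - rewrite -[X in measurable X]setTI; apply: measurable_midpoint => //.
    by apply: measurableI => //; exact: measurable_itv.
  - exact: measurable_itv.
  apply: leeD.
    rewrite -(lebesgue_measure_midpoint b)//.
    by apply: measurableI => //; exact: measurable_itv.
  by apply: lebesgue_measure_itv_le; lra.
have LB : (L B <= 2%:E * L (C `&` `]m, +oo[%classic) + (e / 2)%:E)%E.
  apply: (@le_trans _ _ (L ((fun x : RR => (x + a) / 2) @^-1`
      (C `&` `]m, +oo[%classic) `|` `[(inf B), b]%classic))).
    apply: le_measure; rewrite ?inE//.
      apply: measurableU; last exact: measurable_itv.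
      rewrite -[X in measurable X]setTI; apply: measurable_midpoint => //.
      by apply: measurableI => //; exact: measurable_itv.
    move=> x Bx /=; have xs : inf B <= x by apply: ge_inf => //; exact: hB.2.
    have [xb|bx] := leP x b; first by right; rewrite in_itv/= xb xs.
    by left; split; [rewrite addrC; exact: ABC|rewrite in_itv/= andbT /m; lra].
  apply: (le_trans (measureU2 _ _ _)).
  - rewrite -[X in measurable X]setTI; apply: measurable_midpoint => //.
    by apply: measurableI => //; exact: measurable_itv.
  - exact: measurable_itv.
  apply: leeD.
    rewrite -(lebesgue_measure_midpoint a)//.
    by apply: measurableI => //; exact: measurable_itv.
  by apply: lebesgue_measure_itv_le; lra.
apply: (le_trans (leeD LA LB)).
rewrite addeACA -EFinD -splitr; apply: leeD => //.
rewrite -ge0_muleDr//; apply: lee_pmul => //; first exact: adde_ge0.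
rewrite -measureU.
- apply: le_measure; rewrite ?inE//; last by move=> x [[]|[]].
  by apply: measurableU; apply: measurableI => //; exact: measurable_itv.
- by apply: measurableI => //; exact: measurable_itv.
- by apply: measurableI => //; exact: measurable_itv.
- rewrite -subset0 => x [[_ /=]]; rewrite in_itv/= => xm [_ /=].
  by rewrite in_itv/= andbT ltNge xm.
Qed.

End brunn_minkowski.

(** * The layer-cake formula *)

Section layer_cake.
Context {R : realType} {d : measure_display} {T : measurableType d}.
Variable m : {sigma_finite_measure set T -> \bar R}.
Local Notation L := (@lebesgue_measure R).
Local Notation RR := (measurableTypeR R).
Variable f : T -> \bar R.
Hypothesis mf : measurable_fun setT f.
Hypothesis f0 : forall x, (0 <= f x)%E.

(** The region under the graph of [f]: its sections at fixed [x] are intervals of length [f x],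
    those at a level [t > 0] are superlevel sets. Tonelli's theorem on its indicator gives the
    formula. *)
Let S := [set z : T * RR | 0 < (z.2 : R) /\ (((z.2 : R)%:E) < f z.1)%E].

Let mS : measurable S.
Proof.
rewrite (_ : S = (fun z : T * RR => 0 < (z.2 : R)) @^-1` [set true] `&`
   (fun z : T * RR => (((z.2 : R)%:E) < f z.1)%E) @^-1` [set true]); last first.
  by apply/seteqP; split => z [].
apply: measurableI.
- rewrite -[X in measurable X]setTI.
  by apply: measurable_fun_ltr => //; exact: measurable_snd.
- rewrite -[X in measurable X]setTI; apply: measurable_fun_lte => //.
    by apply/measurable_EFinP; exact: measurable_snd.
  by apply: measurableT_comp => //; exact: measurable_fst.
Qed.

Let mg : measurable_fun setT (fun z => (\1_S z)%:E : \bar R).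
Proof. exact/measurable_EFinP/measurable_indic. Qed.

Let section_le (t : RR) : (\int[m]_x (\1_S (x, t))%:E)%E =
  (if (0 < t :> R)%R then m [set x | t%:E < f x] else 0)%E.
Proof.
have := @integral_indic _ _ _ m setT measurableT (ysection S t)
  (measurable_ysection t mS).
rewrite setIT.
under eq_integral do rewrite indicE.
move=> h; transitivity (m (ysection S t)).
  by rewrite -h; apply: eq_integral => x _; rewrite indicE mem_ysection.
case: ifPn => t0.
  congr (m _); apply/seteqP.
  by split => x; rewrite /ysection/= inE /S/=; [case|split].
rewrite (_ : ysection _ _ = set0) ?measure0// -subset0 => x.
by rewrite /ysection/= inE /S/= => -[]; rewrite (negbTE t0).
Qed.

Lemma measurable_superlevel :
  measurable_fun [set t : RR | 0 < (t : R)] (fun t : RR => m [set x | t%:E < f x]%E).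
Proof.
have := measurable_fun_fubini_tonelli_G (m1 := m) _ mg.
rewrite /fubini_G => /(_ _)/wrap[z|]; first by rewrite lee_fin.
move=> /(measurable_funS measurableT (@subsetT RR [set t : RR | 0 < (t : R)])).
apply: eq_measurable_fun => t; rewrite inE/= => t0.
by rewrite section_le t0.
Qed.

Lemma layer_cake :
  (\int[m]_x f x =
   \int[L]_(t in [set t : RR | 0 < (t : R)]%R) m [set x | t%:E < f x])%E.
Proof.
transitivity (\int[m]_x \int[L]_t (\1_S (x, t))%:E)%E.
  apply: eq_integral => x _.
  have := @integral_indic _ _ _ L setT measurableT (xsection S x)
    (measurable_xsection x mS).
  rewrite setIT => h; transitivity (L (xsection S x)); last first.
    by rewrite -h; apply: eq_integral => t _; rewrite !indicE mem_xsection.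
  rewrite (_ : xsection S x = [set` Interval (BSide false 0)
      (if f x is r%:E then BSide true r else +oo%O)]); last first.
    apply/seteqP; split => t; rewrite /xsection/= inE /S/= in_itv/=.
      move=> [t0]; rewrite t0/=; case: (f x) => [r|//|//].
      by rewrite lte_fin.
    move=> /andP[t0 h2]; split => //; move: h2 (f0 x).
    case: (f x) => [r|_ _|_]; [by rewrite lte_fin|by rewrite ltry|].
    by rewrite leNgt ltNy0.
  have := f0 x; case: (f x) => [r r0|_|].
  - rewrite [RHS](lebesgue_measure_itv `]0, r[)/= lte_fin.
    move: r0; rewrite lee_fin le_eqVlt => /predU1P[<-|r0].
      by rewrite ltxx.
    by rewrite r0 -EFinB subr0.
  - by rewrite [RHS](lebesgue_measure_itv `]0, +oo[)/= ltry.
  - by rewrite leNgt ltNy0.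
rewrite (fubini_tonelli (m1 := m) (m2 := L) _ mg); last first.
  by move=> z; rewrite lee_fin.
rewrite [RHS]integral_mkcond; apply: eq_integral => t _.
by rewrite section_le patchE mem_setE.
Qed.

End layer_cake.

(** * The one-dimensional inequality for bounded functions *)

Section prekopa_leindler_line.
Context {R : realType}.
Local Notation L := (@lebesgue_measure R).
Local Notation RR := (measurableTypeR R).
Implicit Types f g h : RR -> \bar R.
Local Open Scope ereal_scope.

Let measurable_superset (f : RR -> \bar R) (t : R) :
  measurable_fun setT f -> measurable ([set x | t%:E < f x] : set RR).
Proof.
by move=> mf; rewrite -[X in measurable X]setTI; exact: emeasurable_fun_o_infty.
Qed.

(** Midpoints of points of [{f > t}] and [{g > t}] lie in [{h > t}]. As both suprema are [1], these
    sets are nonempty for [t < 1]; the Brunn-Minkowski inequality holds level by level and is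
    integrated by the layer-cake formula. *)
Lemma prekopa_leindler_line_unit f g h (r : R) :
  measurable_fun setT f -> measurable_fun setT g -> measurable_fun setT h ->
  (forall x, 0 <= f x) -> (forall x, 0 <= g x) -> (forall x, 0 <= h x) ->
  (forall x, f x <= 1) -> (forall x, g x <= 1) ->
  (forall t : R, t%:E < 1 -> exists x, t%:E < f x) ->
  (forall t : R, t%:E < 1 -> exists x, t%:E < g x) ->
  (forall x : R, (r < `|x|)%R -> f x = 0) ->
  (forall x : R, (r < `|x|)%R -> g x = 0) ->
  (forall x y : R, f x * g y <= h ((x + y) / 2)%R * h ((x + y) / 2)%R) ->
  \int[L]_x f x + \int[L]_x g x <= 2%:E * \int[L]_x h x.
Proof.
move=> mf mg mh f0 g0 h0 f1 g1 fs gs fr gr fgh.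
rewrite !(layer_cake L)//.
have mpos : measurable ([set t : RR | (0 < (t : R))%R]).
  rewrite (_ : [set t | _] = `]0%R, +oo[%classic); first exact: measurable_itv.
  by apply/seteqP; split => t /=; rewrite in_itv/= andbT.
have ms k : measurable_fun setT k -> (forall x, 0 <= k x) ->
    measurable_fun [set t : RR | (0 < (t : R))%R]
      (fun t : RR => L [set x | t%:E < k x]).
  by move=> mk k0; exact: measurable_superlevel.
rewrite -ge0_integralD//; [|exact: ms..].
rewrite -ge0_integralZl_EFin//; [|exact: ms..].
apply: ge0_le_integral => //.
- by move=> t _; exact: adde_ge0.
- by apply: emeasurable_funD; exact: ms.
- by apply: measurable_funeM; exact: ms.
move=> t /= t0; have [t1|t1] := ltP (t : R) 1%R; last first.
  have empty k : (forall x, k x <= 1) -> L [set x | t%:E < k x] = 0.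
    move=> k1; rewrite [X in L X](_ : _ = set0); first exact: measure0.
    rewrite -subset0 => x /=; apply/negP; rewrite -leNgt.
    by rewrite (le_trans (k1 x))// lee_fin.
  by rewrite (empty f f1) (empty g g1) adde0 mule_ge0.
have supp k (kr : forall x : R, (r < `|x|)%R -> k x = 0) (x : R) :
    t%:E < k x -> (`|x| <= r)%R.
  move=> tk; rewrite leNgt; apply/negP => /kr kx0.
  by move: tk; rewrite kx0 lte_fin ltNge ltW.
apply: (@brunn_minkowski_line R _ _ _ r); try exact: measurable_superset.
- by apply: fs; rewrite lte_fin.
- by apply: gs; rewrite lte_fin.
- by move=> x /=; exact: supp.
- by move=> x /=; exact: supp.
move=> x y /= tf tg; rewrite ltNge; apply/negP => ht.
have : (t * t)%:E < f x * g y.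
  by rewrite EFinM; apply: lte_pmul => //; rewrite lee_fin ltW.
apply/negP; rewrite -leNgt; apply: (le_trans (fgh x y)).
by rewrite EFinM; apply: lee_pmul.
Qed.

Let amgm_ereal (x y z : \bar R) (m n : R) : (0 < m)%R -> (0 < n)%R ->
  0 <= x -> 0 <= y -> 0 <= z ->
  (m^-1)%:E * x + (n^-1)%:E * y <= 2%:E * (((Num.sqrt (m * n))^-1)%:E * z) ->
  x * y <= z * z.
Proof.
move=> m0 n0; case: z => [z|_ _ _ _|//]; last by rewrite mulyy leey.
have s0 : (0 < Num.sqrt (m * n))%R by rewrite sqrtr_gt0 mulr_gt0.
case: x => [x| |//]; last first.
  move=> _ y0 z0; rewrite gt0_muley ?lte_fin ?invr_gt0//.
  have ny : (n^-1)%:E * y != -oo.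
    by rewrite gt_eqF// (lt_le_trans (ltNyr 0))// mule_ge0// lee_fin invr_ge0 ltW.
  by rewrite addye// -!EFinM leNgt ltry.
case: y => [y| |//]; last first.
  by move=> _ _ z0; rewrite gt0_muley ?lte_fin ?invr_gt0.
rewrite !lee_fin => x0 y0 z0 h.
set s := Num.sqrt (m * n) in h s0.
have ss : (s ^+ 2 = m * n)%R by rewrite sqr_sqrtr// mulr_ge0 ?ltW.
set a := (m^-1 * x)%R in h; set b := (n^-1 * y)%R in h; set c := (s^-1 * z)%R in h.
have a0 : (0 <= a)%R by rewrite mulr_ge0// invr_ge0 ltW.
have b0 : (0 <= b)%R by rewrite mulr_ge0// invr_ge0 ltW.
have c0 : (0 <= c)%R by rewrite mulr_ge0// invr_ge0 ltW.
have -> : (x * y = s ^+ 2 * (a * b))%R.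
  by rewrite ss /a /b; field; rewrite !gt_eqF.
have -> : (z * z = s ^+ 2 * (c * c))%R by rewrite /c; field; rewrite gt_eqF.
rewrite ler_wpM2l ?sqr_ge0//.
move: (a) (b) (c) a0 b0 c0 h; clear => a b c a0 b0 c0.
by have := sqr_ge0 (a - b)%R; nra.
Qed.

(** Dividing [f] and [g] by their suprema [m] and [n], and [h] by [Num.sqrt (m * n)], gives the
    additive inequality, which AM-GM turns into the product form. *)
Lemma prekopa_leindler_line_bounded f g h (r K : R) :
  measurable_fun setT f -> measurable_fun setT g -> measurable_fun setT h ->
  (forall x, 0 <= f x) -> (forall x, 0 <= g x) -> (forall x, 0 <= h x) ->
  (forall x, f x <= K%:E) -> (forall x, g x <= K%:E) ->
  (forall x : R, (r < `|x|)%R -> f x = 0) ->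
  (forall x : R, (r < `|x|)%R -> g x = 0) ->
  (forall x y : R, f x * g y <= h ((x + y) / 2)%R * h ((x + y) / 2)%R) ->
  \int[L]_x f x * \int[L]_x g x <= \int[L]_x h x * \int[L]_x h x.
Proof.
move=> mf mg mh f0 g0 h0 fK gK fr gr fgh.
have Ih0 : 0 <= \int[L]_x h x * \int[L]_x h x.
  by rewrite mule_ge0// integral_ge0.
have [[x0 fx0]|fz] := pselect (exists x, 0 < f x); last first.
  rewrite (_ : \int[L]_x f x = 0) ?mul0e//; apply: integral0_eq => x _.
  apply/eqP; rewrite eq_le f0 andbT leNgt; apply/negP => fx.
  by apply: fz; exists x.
have [[y0 gy0]|gz] := pselect (exists x, 0 < g x); last first.
  rewrite (_ : \int[L]_x g x = 0) ?mule0//; apply: integral0_eq => x _.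
  apply/eqP; rewrite eq_le g0 andbT leNgt; apply/negP => gx.
  by apply: gz; exists x.
have sup_fin (k : RR -> \bar R) z : 0 < k z -> (forall x, k x <= K%:E) ->
    exists m : R, [/\ (0 < m)%R, forall x, k x <= m%:E &
      forall t : R, (t < m)%R -> exists x, t%:E < k x].
  move=> kz kK; have supK : ereal_sup (range k) <= K%:E.
    by apply: ge_ereal_sup => _ [x _ <-].
  have sup0 : 0 < ereal_sup (range k).
    by apply: (lt_le_trans kz); apply: ereal_sup_ubound; exists z.
  have supf : ereal_sup (range k) \is a fin_num.
    by rewrite ge0_fin_numE ?(ltW sup0)// (le_lt_trans supK) ?ltry.
  exists (fine (ereal_sup (range k))); split.
  - by rewrite -lte_fin fineK.
  - by move=> x; rewrite fineK//; apply: ereal_sup_ubound; exists x.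
  - move=> t; rewrite -lte_fin fineK// => /ereal_sup_gt[_ [x _ <-] tx].
    by exists x.
have [m [m0 fm fsup]] := sup_fin f x0 fx0 fK.
have [n [n0 gn gsup]] := sup_fin g y0 gy0 gK.
have s0 : (0 < Num.sqrt (m * n))%R by rewrite sqrtr_gt0 mulr_gt0.
apply: (amgm_ereal m0 n0); try exact: integral_ge0.
rewrite -3?ge0_integralZl_EFin// ?invr_ge0 ?(ltW m0) ?(ltW n0) ?(ltW s0)//.
have scale (k : RR -> \bar R) (p : R) : (0 < p)%R -> (forall x, 0 <= k x) ->
    (forall x, k x <= p%:E) ->
    (forall t : R, (t < p)%R -> exists x, t%:E < k x) ->
  [/\ forall x, 0 <= (p^-1)%:E * k x, forall x, (p^-1)%:E * k x <= 1 &
    forall t : R, t%:E < 1 -> exists x, t%:E < (p^-1)%:E * k x].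
  move=> p0 k0 kp ksup; split => [x|x|t].
  - by rewrite mule_ge0// lee_fin invr_ge0 ltW.
  - rewrite (_ : 1 = (p^-1)%:E * p%:E); last by rewrite -EFinM mulVf// gt_eqF.
    by rewrite lee_pmul2l// lte_fin invr_gt0.
  - rewrite lte_fin => t1; have [|x tx] := ksup (t * p)%R.
      by rewrite gtr_pMl.
    exists x; rewrite (_ : t = p^-1 * (t * p))%R; last first.
      by rewrite mulrC mulfK// gt_eqF.
    by rewrite EFinM lte_pmul2l// lte_fin invr_gt0.
have [F0 F1 Fs] := scale f m m0 f0 fm fsup.
have [G0 G1 Gs] := scale g n n0 g0 gn gsup.
apply: (@prekopa_leindler_line_unit (fun x => (m^-1)%:E * f x)
  (fun x => (n^-1)%:E * g x) (fun x => ((Num.sqrt (m * n))^-1)%:E * h x) r) => //;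
  try exact: measurable_funeM.
- by move=> x; rewrite mule_ge0// lee_fin invr_ge0 ltW.
- by move=> x /fr ->; rewrite mule0.
- by move=> x /gr ->; rewrite mule0.
move=> x y; rewrite muleACA [leRHS]muleACA -!EFinM -!invfM.
rewrite -expr2 sqr_sqrtr ?mulr_ge0 ?(ltW m0) ?(ltW n0)//.
by rewrite lee_pmul2l// lte_fin invr_gt0 mulr_gt0.
Qed.

End prekopa_leindler_line.

Section prekopa_leindler.
Context {R : realType}.
Local Open Scope ereal_scope.

(** The midpoint map is abstract so that the property passes to products and images. Integrals stay
    in [\bar R], infinite values included. *)
Definition prekopa_leindler {d} {T : measurableType d} (mid : T -> T -> T)
    (m : {measure set T -> \bar R}) :=
  forall f g h : T -> \bar R,
  measurable_fun setT f -> measurable_fun setT g -> measurable_fun setT h ->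
  (forall x, 0 <= f x) -> (forall x, 0 <= g x) -> (forall x, 0 <= h x) ->
  (forall x y, f x * g y <= h (mid x y) * h (mid x y)) ->
  \int[m]_x f x * \int[m]_x g x <= \int[m]_x h x * \int[m]_x h x.

Let mule_lim_le (u : (\bar R)^nat) (l y c : \bar R) : 0 <= y -> 0 <= c ->
  (forall n, 0 <= u n) -> u @ \oo --> l -> (forall n, u n * y <= c) -> l * y <= c.
Proof.
move=> y0 c0 u0 ul uc.
have l0 : 0 <= l.
  rewrite -(cvg_lim _ ul)//.
  by apply: lime_ge; [by apply/cvg_ex; exists l|exact: nearW].
(* Multiplication on [\bar R] is not continuous at [0 * +oo], but the claim is trivial when a factor
   vanishes. *)
have [->|l_neq0] := eqVneq l 0; first by rewrite mul0e.
have [->|y_neq0] := eqVneq y 0; first by rewrite mule0.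
have ly : l *? y.
  by apply: neq0_mule_def; rewrite mule_eq0 negb_or l_neq0.
have uy : u n * y @[n --> \oo] --> l * y by apply: cvgeM => //; exact: cvg_cst.
rewrite -(cvg_lim _ uy)//; apply: lime_le; first by apply/cvg_ex; exists (l * y).
exact: nearW.
Qed.

Section truncation.
Local Notation L := (@lebesgue_measure R).
Local Notation RR := (measurableTypeR R).

(** Height and support are cut together, and the truncations increase to [f]. *)
Let trunc (f : RR -> \bar R) (n : nat) (x : RR) : \bar R :=
  if (`|x : R| <= n%:R)%R then mine (f x) n%:R%:E else 0.

Let truncP (f : RR -> \bar R) : measurable_fun setT f -> (forall x, 0 <= f x) ->
  [/\ forall n, measurable_fun setT (trunc f n), forall n x, 0 <= trunc f n x,
   forall n x, trunc f n x <= n%:R%:E, forall n x, trunc f n x <= f x &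
   forall n (x : R), (n%:R < `|x|)%R -> trunc f n x = 0] /\
  \int[L]_x trunc f n x @[n --> \oo] --> \int[L]_x f x.
Proof.
move=> mf f0.
have mt n : measurable_fun setT (trunc f n).
  apply: measurable_fun_ifT.
  - apply: measurable_fun_ler; last exact: measurable_cst.
    exact: (measurableT_comp (@normr_measurable R setT)).
  - by apply: measurable_mine => //; exact: measurable_cst.
  - exact: measurable_cst.
have t0 n x : 0 <= trunc f n x.
  by rewrite /trunc; case: ifP => _; rewrite ?le_min ?f0 ?lee_fin ?ler0n.
have tn n x : trunc f n x <= n%:R%:E.
  by rewrite /trunc; case: ifP => _; rewrite ?ge_min ?lexx ?orbT ?lee_fin ?ler0n.
have tf n x : trunc f n x <= f x.
  by rewrite /trunc; case: ifP => _; rewrite ?ge_min ?lexx.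
split.
  split => // n x nx.
  by rewrite /trunc ifF//; apply/negbTE; rewrite -ltNge.
have homo_t x : {homo trunc f ^~ x : n m / (n <= m)%N >-> n <= m}.
  move=> n m nm; rewrite {1}/trunc; case: ifPn => // xn.
  rewrite /trunc (le_trans xn) ?ler_nat//.
  rewrite le_min !ge_min lexx/= lee_fin ler_nat nm orbT//.
have := @cvg_monotone_convergence _ _ _ L setT measurableT _ mt
  (fun n x _ => t0 n x) (fun x _ => homo_t x).
rewrite (_ : \int[L]_x limn _ = \int[L]_x f x)//.
apply: eq_integral => x _; apply/cvg_lim => //.
have := f0 x; rewrite /trunc; case: (f x) => [r r0|_|//].
- apply: cvg_near_cst; near=> n; rewrite ifT; last by near: n; exact: nbhs_infty_ger.
  by apply: min_l; rewrite lee_fin; near: n; exact: nbhs_infty_ger.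
- apply/cvgeyPge => A; near=> n; rewrite ifT; last by near: n; exact: nbhs_infty_ger.
  rewrite min_r ?leey// lee_fin; near: n; exact: nbhs_infty_ger.
Unshelve. all: by end_near. Qed.

Lemma prekopa_leindler_line :
  prekopa_leindler (fun x y : RR => ((x + y) / 2)%R) L.
Proof.
move=> f g h mf mg mh f0 g0 h0 fgh.
have [[mft ft0 ftn ftf ftr] cvgf] := truncP mf f0.
have [[mgt gt0 gtn gtg gtr] cvgg] := truncP mg g0.
have If n : 0 <= \int[L]_x trunc f n x by exact: integral_ge0.
have Ig n : 0 <= \int[L]_x trunc g n x by exact: integral_ge0.
have Ih : 0 <= \int[L]_x h x * \int[L]_x h x.
  by rewrite mule_ge0// integral_ge0.
(* The two limits are taken one after the other, with independent indices, while [h] is kept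
   whole. *)
apply: (mule_lim_le _ _ If cvgf) => //; first exact: integral_ge0.
move=> n; rewrite muleC; apply: (mule_lim_le _ _ Ig cvgg) => // k.
rewrite muleC; pose p := maxn n k.
apply: (@prekopa_leindler_line_bounded _ _ _ _ p%:R p%:R) => //.
- by move=> x; rewrite (le_trans (ftn n x))// lee_fin ler_nat leq_maxl.
- by move=> x; rewrite (le_trans (gtn k x))// lee_fin ler_nat leq_maxr.
- by move=> x px; apply: ftr; rewrite (le_lt_trans _ px)// ler_nat leq_maxl.
- by move=> x px; apply: gtr; rewrite (le_lt_trans _ px)// ler_nat leq_maxr.
- by move=> x y; apply: le_trans (fgh x y); apply: lee_pmul.
Qed.

End truncation.

(** For fixed first coordinates [x] and [x'], the inequality for [m2] on sections is exactly the
    hypothesis of the one for [m1] on the partial integrals. *)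
Lemma prekopa_leindler_prod {d1 d2} {T1 : measurableType d1}
    {T2 : measurableType d2} (mid1 : T1 -> T1 -> T1) (mid2 : T2 -> T2 -> T2)
    (m1 : {sigma_finite_measure set T1 -> \bar R})
    (m2 : {sigma_finite_measure set T2 -> \bar R}) :
  prekopa_leindler mid1 m1 -> prekopa_leindler mid2 m2 ->
  prekopa_leindler (fun p q => (mid1 p.1 q.1, mid2 p.2 q.2)) (m1 \x m2).
Proof.
move=> pl1 pl2 f g h mf mg mh f0 g0 h0 fgh.
rewrite (fubini_tonelli1 f mf f0) (fubini_tonelli1 g mg g0).
rewrite (fubini_tonelli1 h mh h0).
have sec (k : T1 * T2 -> \bar R) x : measurable_fun setT k ->
    measurable_fun setT (fun y => k (x, y)).
  by move=> mk; apply: measurableT_comp => //; exact: measurable_pair1.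
apply: pl1; try exact: measurable_fun_fubini_tonelli_F.
- by move=> x; apply: integral_ge0.
- by move=> x; apply: integral_ge0.
- by move=> x; apply: integral_ge0.
by move=> x x'; apply: pl2 => //; exact: sec.
Qed.

Lemma prekopa_leindler_pushforward {d1 d2} {T1 : measurableType d1}
    {T2 : measurableType d2} (mid1 : T1 -> T1 -> T1) (mid2 : T2 -> T2 -> T2)
    (m : {measure set T1 -> \bar R}) (m' : {measure set T2 -> \bar R})
    (phi : T1 -> T2) : measurable_fun setT phi ->
  (forall x y, phi (mid1 x y) = mid2 (phi x) (phi y)) ->
  m' = pushforward m phi :> (set T2 -> \bar R) ->
  prekopa_leindler mid1 m -> prekopa_leindler mid2 m'.
Proof.
move=> mphi phi_mid m'E pl f g h mf mg mh f0 g0 h0 fgh.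
have intE (k : T2 -> \bar R) : measurable_fun setT k -> (forall x, 0 <= k x) ->
    \int[m']_x k x = \int[m]_x k (phi x).
  move=> mk k0; transitivity (\int[pushforward m phi]_x k x).
    by apply: eq_measure_integral => A mA _; rewrite m'E.
  by rewrite ge0_integral_pushforward// preimage_setT.
rewrite !intE//; apply: pl => //; try exact: measurableT_comp.
by move=> x y; rewrite phi_mid; exact: fgh.
Qed.

Lemma prekopa_leindler_rV n :
  prekopa_leindler (fun x y : 'rV[R]_n => 2^-1 *: (x + y))%R (lebesgue_rV R n).
Proof.
elim: n => [|n IHn].
  move=> f g h mf mg mh f0 g0 h0 fgh.
  rewrite /= !integral_dirac// !diracE !mem_set// !mul1e.
  by have := fgh 0%R 0%R; rewrite addr0 scaler0.
have step := @prekopa_leindler_pushforward _ _ _ _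
  (fun p q : measurableTypeR R * 'rV[R]_n =>
    (((p.1 : R) + (q.1 : R)) / 2 : measurableTypeR R, 2^-1 *: (p.2 + q.2))%R)
  (fun x y : 'rV[R]_n.+1 => 2^-1 *: (x + y))%R
  (@lebesgue_measure R \x lebesgue_rV R n) (lebesgue_rV R n.+1) (@cons_rV R n)
  (@measurable_cons_rV R n).
apply: step => //.
- move=> [a x] [b y]; apply/rowP => i; rewrite !mxE/=.
  case: (unliftP ord0 i) => [j|] _ /=; first by rewrite !mxE.
  by rewrite mulrC.
- exact: (prekopa_leindler_prod prekopa_leindler_line IHn).
Qed.

End prekopa_leindler.

(** * Reduction to bounded costs and potentials *)

Lemma ae_eq_mean {R : realType} {d} {T : measurableType d} (P : probability T R)
    (f g : T -> R) :
  measurable_fun setT f -> measurable_fun setT g ->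
  {ae P, forall x, f x = g x} -> \int[P]_x f x = \int[P]_x g x.
Proof.
move=> mf mg fg; congr fine; apply: ae_eq_integral => //;
  try exact/measurable_EFinP.
by apply: filterS fg => x -> _.
Qed.

Section measurable_mean.
Context {R : realType} {d1 d2 : measure_display}.
Context {T1 : measurableType d1} {T2 : measurableType d2}.
Variable mu : probability T1 R.

Lemma measurable_mean (h : T1 * T2 -> R) : measurable_fun setT h ->
  (forall z, 0 <= h z) -> measurable_fun setT (fun y => \int[mu]_x h (x, y)).
Proof.
move=> mh h0; apply: measurableT_comp => //.
have mh' : measurable_fun setT (EFin \o h) by exact/measurable_EFinP.
by apply: (measurable_fun_fubini_tonelli_G (m1 := mu) _ mh') => z; rewrite lee_fin.
Qed.

Lemma measurable_transformX (c : T1 -> T2 -> R) (lambda : R) (phi : T1 -> R) :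
  measurable_fun setT (fun z : T1 * T2 => c z.1 z.2) -> measurable_fun setT phi ->
  measurable_fun setT (transformX mu c lambda phi).
Proof.
move=> mc mphi; apply: measurable_funM => //; apply: measurableT_comp => //.
apply: (@measurable_mean (fun z => expR ((phi z.1 - c z.1 z.2) / lambda))) => [|z].
  apply: measurableT_comp => //; apply: measurable_funM => //.
  apply: measurable_funB => //.
  exact: (measurableT_comp mphi measurable_fst).
exact: expR_ge0.
Qed.

End measurable_mean.

Section ae_invariance.
Context {R : realType} {d1 d2 : measure_display}.
Context {T1 : measurableType d1} {T2 : measurableType d2}.
Variables (mu : probability T1 R) (nu : probability T2 R).
Variables (c c' : T1 -> T2 -> R) (lambda : R) (A : set T1) (B : set T2).
Hypothesis mc : measurable_fun setT (fun z : T1 * T2 => c z.1 z.2).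
Hypothesis mc' : measurable_fun setT (fun z : T1 * T2 => c' z.1 z.2).
Hypothesis aeA : {ae mu, forall x, A x}.
Hypothesis aeB : {ae nu, forall y, B y}.
Hypothesis cc' : forall x y, A x -> B y -> c x y = c' x y.

(** Equality is claimed only for [y] in [B], where the costs agree for almost every [x]; as [B] has
    full measure, almost everywhere equality then propagates through all iterates. *)
Lemma transformX_ae phi phi' y : measurable_fun setT phi ->
  measurable_fun setT phi' -> {ae mu, forall x, phi x = phi' x} -> B y ->
  transformX mu c lambda phi y = transformX mu c' lambda phi' y.
Proof.
move=> mphi mphi' ae By; congr (_ * ln _).
have mk (k : T1 -> T2 -> R) (f : T1 -> R) :
    measurable_fun setT (fun z : T1 * T2 => k z.1 z.2) ->
    measurable_fun setT f ->
    measurable_fun setT (fun x => expR ((f x - k x y) / lambda)).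
  move=> mk mf; apply: measurableT_comp => //; apply: measurable_funM => //.
  apply: measurable_funB => //.
  exact: (measurableT_comp mk (measurable_pair2 y)).
apply: ae_eq_mean; [exact: mk|exact: mk|].
by apply: filterS2 aeA ae => x Ax ->; rewrite cc'.
Qed.

Let dual_congr (r r' s s' k k' : R) : r = r' -> s = s' -> k = k' ->
  r + s + lambda * (1 - k) = r' + s' + lambda * (1 - k').
Proof. by move=> -> -> ->. Qed.

Lemma dual_fun_ae phi phi' psi psi' :
  measurable_fun setT phi -> measurable_fun setT phi' ->
  measurable_fun setT psi -> measurable_fun setT psi' ->
  {ae mu, forall x, phi x = phi' x} -> {ae nu, forall y, psi y = psi' y} ->
  dual_fun mu nu c lambda phi psi = dual_fun mu nu c' lambda phi' psi'.
Proof.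
move=> mphi mphi' mpsi mpsi' ae1 ae2; rewrite /dual_fun.
have mk (k : T1 -> T2 -> R) (f : T1 -> R) (g : T2 -> R) :
    measurable_fun setT (fun z : T1 * T2 => k z.1 z.2) ->
    measurable_fun setT f -> measurable_fun setT g ->
    measurable_fun setT (fun z : T1 * T2 =>
      expR ((f z.1 + g z.2 - k z.1 z.2) / lambda)).
  move=> mk mf mg; apply: measurableT_comp => //; apply: measurable_funM => //.
  apply: measurable_funB => //; apply: measurable_funD.
    exact: (measurableT_comp mf measurable_fst).
  exact: (measurableT_comp mg measurable_snd).
have e0 (k : T1 -> T2 -> R) (f : T1 -> R) (g : T2 -> R) (z : T1 * T2) :
  0 <= expR ((f z.1 + g z.2 - k z.1 z.2) / lambda) by exact: expR_ge0.
have E1 := ae_eq_mean mphi mphi' ae1; have E2 := ae_eq_mean mpsi mpsi' ae2.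
apply: (dual_congr E1 E2); apply: ae_eq_mean.
- exact: (measurable_mean mu (mk _ _ _ mc mphi mpsi) (e0 _ _ _)).
- exact: (measurable_mean mu (mk _ _ _ mc' mphi' mpsi') (e0 _ _ _)).
apply: filterS2 aeB ae2 => y By ->.
apply: ae_eq_mean.
- exact: (measurableT_comp (mk _ _ _ mc mphi mpsi') (measurable_pair2 y)).
- exact: (measurableT_comp (mk _ _ _ mc' mphi' mpsi') (measurable_pair2 y)).
by apply: filterS2 aeA ae1 => x Ax ->; rewrite cc'.
Qed.

End ae_invariance.

Section sinkhorn_ae.
Context {R : realType} {d1 d2 : measure_display}.
Context {T1 : measurableType d1} {T2 : measurableType d2}.
Variables (mu : probability T1 R) (nu : probability T2 R).
Variables (c c' : T1 -> T2 -> R) (lambda : R) (A : set T1) (B : set T2).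
Hypothesis mc : measurable_fun setT (fun z : T1 * T2 => c z.1 z.2).
Hypothesis mc' : measurable_fun setT (fun z : T1 * T2 => c' z.1 z.2).
Hypothesis aeA : {ae mu, forall x, A x}.
Hypothesis aeB : {ae nu, forall y, B y}.
Hypothesis cc' : forall x y, A x -> B y -> c x y = c' x y.

Let measurable_swapped (k : T1 -> T2 -> R) :
  measurable_fun setT (fun z : T1 * T2 => k z.1 z.2) ->
  measurable_fun setT (fun z : T2 * T1 => k z.2 z.1).
Proof. by move=> mk; exact: (measurableT_comp mk (@measurable_swap _ _ T2 T1)). Qed.

Lemma measurable_transformY (k : T1 -> T2 -> R) (psi : T2 -> R) :
  measurable_fun setT (fun z : T1 * T2 => k z.1 z.2) ->
  measurable_fun setT psi -> measurable_fun setT (transformY nu k lambda psi).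
Proof.
move=> /measurable_swapped mk.
exact: (measurable_transformX nu (c := fun y x => k x y) lambda mk).
Qed.

Lemma transformY_ae psi psi' x : measurable_fun setT psi ->
  measurable_fun setT psi' -> {ae nu, forall y, psi y = psi' y} -> A x ->
  transformY nu c lambda psi x = transformY nu c' lambda psi' x.
Proof.
move=> mpsi mpsi' ae Ax.
apply: (transformX_ae (c := fun y x => c x y) (c' := fun y x => c' x y)
  (B := A) lambda (measurable_swapped mc) (measurable_swapped mc') aeB) => //.
by move=> y z By Az; exact: cc'.
Qed.

Lemma measurable_sinkhorn_psi (k : T1 -> T2 -> R) psi t :
  measurable_fun setT (fun z : T1 * T2 => k z.1 z.2) ->
  measurable_fun setT psi ->
  measurable_fun setT (sinkhorn_psi mu nu k lambda psi t).
Proof.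
move=> mk mpsi; elim: t => [//|t IHt].
by apply: measurable_transformX => //; exact: measurable_transformY.
Qed.

Lemma sinkhorn_psi_ae psi psi' t : measurable_fun setT psi ->
  measurable_fun setT psi' -> {ae nu, forall y, psi y = psi' y} ->
  {ae nu, forall y, sinkhorn_psi mu nu c lambda psi t y =
                    sinkhorn_psi mu nu c' lambda psi' t y}.
Proof.
move=> mpsi mpsi' ae; elim: t => [//|t IHt].
have m1 := measurable_sinkhorn_psi t mc mpsi.
have m2 := measurable_sinkhorn_psi t mc' mpsi'.
have aeY : {ae mu, forall x,
    transformY nu c lambda (sinkhorn_psi mu nu c lambda psi t) x =
    transformY nu c' lambda (sinkhorn_psi mu nu c' lambda psi' t) x}.
  by apply: filterS aeA => x; exact: transformY_ae.
apply: filterS aeB => y By.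
exact: (transformX_ae lambda mc mc' aeA cc' (measurable_transformY mc m1)
  (measurable_transformY mc' m2) aeY By).
Qed.

Lemma dual_sinkhorn_ae psi psi' t : measurable_fun setT psi ->
  measurable_fun setT psi' -> {ae nu, forall y, psi y = psi' y} ->
  dual_fun mu nu c lambda (sinkhorn_phi mu nu c lambda psi t)
    (sinkhorn_psi mu nu c lambda psi t) =
  dual_fun mu nu c' lambda (sinkhorn_phi mu nu c' lambda psi' t)
    (sinkhorn_psi mu nu c' lambda psi' t).
Proof.
move=> mpsi mpsi' ae.
have m1 := measurable_sinkhorn_psi t mc mpsi.
have m2 := measurable_sinkhorn_psi t mc' mpsi'.
have aet := sinkhorn_psi_ae t mpsi mpsi' ae.
have aeY : {ae mu, forall x,
    transformY nu c lambda (sinkhorn_psi mu nu c lambda psi t) x =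
    transformY nu c' lambda (sinkhorn_psi mu nu c' lambda psi' t) x}.
  by apply: filterS aeA => x; exact: transformY_ae.
exact: (dual_fun_ae lambda mc mc' aeA aeB cc' (measurable_transformY mc m1)
  (measurable_transformY mc' m2) m1 m2 aeY aet).
Qed.

End sinkhorn_ae.

Section essentially_bounded.
Context {R : realType} {d : measure_display} {T : measurableType d}.
Variable P : probability T R.

Lemma bddm_Lfun (f : T -> R) : bddm f -> f \in Lfun P +oo%E.
Proof.
move=> [mf [M fM]]; rewrite inE; apply/andP; split; rewrite inE//=.
rewrite /finite_norm unlock /=; case: ifP => _; last by rewrite ltry.
apply: (@le_lt_trans _ _ M%:E); last by rewrite ltry.
by apply/ess_supP; apply: nearW => x /=; rewrite lee_fin.
Qed.

(** The function is replaced by [0] where its absolute value exceeds its essential supremum. *)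
Lemma Lfun_bddm (f : T -> R) : f \in Lfun P +oo%E ->
  measurable_fun setT f /\
  exists2 g, bddm g & {ae P, forall x, f x = g x}.
Proof.
rewrite inE => /andP[]; rewrite !inE/= => mf; rewrite /finite_norm unlock /=.
rewrite probability_setT lte01 => fin; split => //.
set s := ess_sup _ _ in fin.
have P1 : (0 < P setT)%E by rewrite probability_setT lte01.
have s0 : (0 <= s)%E.
  by apply: (ess_sup_gee P1); apply: nearW => x; rewrite /= lee_fin.
have sf : s \is a fin_num by rewrite ge0_fin_numE.
pose M := fine s.
exists (fun x => if `|f x| <= M then f x else 0); last first.
  apply: filterS (ess_sup_ge P (abse \o (EFin \o f))) => x /=.
  by rewrite -/s -(fineK sf) lee_fin => ->.
split.
  apply: measurable_fun_ifT => //; apply: measurable_fun_ler => //.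
  exact: measurableT_comp.
by exists M => x; case: ifPn => //; rewrite normr0 fine_ge0.
Qed.

End essentially_bounded.

(** * The linear cost and log-concave measures *)

Section euclidean_support.
Context {R : realType} {d : nat}.
Implicit Types (X Y U : set 'rV[R]_d).

Let ratball (q : 'rV[rat]_d * rat) : set 'rV[R]_d :=
  @ball R 'rV[R]_d (map_mx ratr q.1) (ratr q.2).

Let ratballP U x : open U -> U x -> exists q, ratball q x /\ ratball q `<=` U.
Proof.
move=> oU Ux; have := open_nbhs_nbhs (conj oU Ux).
rewrite -nbhs_ballE => -[e /= e0 xeU].
have [r] : exists r : rat, ratr r \in `](e / 4), (e / 2)[.
  by apply: rat_in_itvoo; rewrite ltr_pM2l// ltf_pV2 ?posrE// ltr_nat.
rewrite in_itv/= => /andP[r1 r2].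
have r0 : 0 < ratr r :> R by rewrite (lt_trans _ r1)// divr_gt0.
have /choice[q qx] (j : 'I_d) :
    exists q : rat, x ord0 j - ratr r < (ratr q : R) < x ord0 j + ratr r.
  have [q] : exists q : rat, ratr q \in `](x ord0 j - ratr r), (x ord0 j + ratr r)[.
    by apply: rat_in_itvoo; rewrite ltrD2l (lt_trans _ r0)// oppr_lt0.
  by rewrite in_itv/=; exists q.
have xq : @ball R 'rV[R]_d x (ratr r) (map_mx ratr (\row_j q j)).
  split => // i j; rewrite !mxE (ord1 i) /ball/= distrC ltr_distl.
  exact: qx.
exists (\row_j q j, r); split; first exact: ball_sym.
move=> y yq; apply: xeU.
apply: (@le_ball _ _ _ (ratr r + ratr r)); last exact: ball_triangle xq yq.
by rewrite (splitr e) lerD// ltW.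
Qed.

(** Every point outside the support lies in a negligible rational ball, and there are countably many
    of these. *)
Lemma ae_msupport (mu : probability 'rV[R]_d R) :
  {ae mu, forall x, msupport mu x}.
Proof.
pose F n : set 'rV[R]_d := if unpickle n is Some q then
  (if `[< mu.-negligible (ratball q) >] then ratball q else set0) else set0.
have : mu.-negligible (\bigcup_n F n).
  apply: negligible_bigcup => n; rewrite /F; case: (unpickle n) => [q|].
    by case: asboolP => // _; exact: negligible_set0.
  exact: negligible_set0.
apply: negligibleS => x /= /existsNP[U] /not_implyP[oU] /not_implyP[Ux].
move=> /negP; rewrite -leNgt => U0.
have [q [qx qU]] := ratballP oU Ux.
exists (pickle q) => //; rewrite /F pickleK; case: asboolP => // -[].
apply: (negligibleS qU); exists U; split => //; first exact: open_measurable_rV.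
by apply/eqP; rewrite eq_le U0/=.
Qed.

Lemma compact_measurable_rV X : compact X -> measurable X.
Proof.
move=> /compact_closed cX; rewrite -[X]setCK; apply: measurableC.
by apply: open_measurable_rV; apply: closed_openC; apply: cX; exact: norm_hausdorff.
Qed.

Lemma compact_coord_bounded X : compact X ->
  exists M, forall x, X x -> forall i, `|x ord0 i| <= M.
Proof.
move=> /compact_bounded[M [_ XM]]; exists (M + 1) => x Xx i.
have : `|x| <= M + 1 by apply: XM => //; rewrite ltrDl.
apply: le_trans; rewrite [leRHS](mx_normrE x).
exact: (le_bigmax _ (fun i : 'I_1 * 'I_d => `|x i.1 i.2|) (ord0, i)).
Qed.

Lemma dotp_bounded X Y : compact X -> compact Y ->
  exists M, forall x y, X x -> Y y -> `|dotp x y| <= M.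
Proof.
move=> /compact_coord_bounded[M XM] /compact_coord_bounded[N YN].
exists (\sum_(i < d) M * N) => x y Xx Yy.
apply: (le_trans (ler_norm_sum _ _ _)); apply: ler_sum => i _.
by rewrite normrM ler_pM ?XM ?YN.
Qed.

Lemma measurable_dotp :
  measurable_fun setT (fun z : 'rV[R]_d * 'rV[R]_d => dotp z.1 z.2).
Proof.
apply: measurable_sum => i; apply: measurable_funM.
  exact: (measurableT_comp (measurable_coord i) measurable_fst).
exact: (measurableT_comp (measurable_coord i) measurable_snd).
Qed.

Lemma dot_cost_osc X Y : compact X -> compact Y -> forall x x' y y',
  X x -> X x' -> Y y -> Y y' ->
  dot_cost x y - dot_cost x' y' <= cost_osc dot_cost X Y.
Proof.
move=> cX cY x x' y y' Xx Xx' Yy Yy'; have [M XYM] := dotp_bounded cX cY.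
apply: lerB.
  apply: ub_le_sup; last by exists x => //; exists y.
  exists M => _ [u Xu [v Yv <-]]; rewrite (le_trans (ler_norm _))// normrN.
  exact: XYM.
apply: ge_inf; last by exists x' => //; exists y'.
exists (- M) => _ [u Xu [v Yv <-]]; rewrite lerN2 (le_trans (ler_norm _))//.
exact: XYM.
Qed.

(** The density agrees almost everywhere with the Radon-Nikodym derivative, for which the change of
    variables is known. *)
Lemma mean_density (mu : probability 'rV[R]_d R) f (g : 'rV[R]_d -> R) :
  is_density mu f -> bddm g ->
  (\int[mu]_x (g x)%:E = \int[lebesgue_rV R d]_x (g x * f x)%:E)%E.
Proof.
move=> [mf f0 muf] bg.
have dom : mu `<< lebesgue_rV R d.
  apply/null_content_dominatesP => A mA A0; rewrite muf//.
  by apply: null_set_integral => //; exact/measurable_EFinP/measurable_funTS.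
have mf' : measurable_fun setT (EFin \o f) by exact/measurable_EFinP.
rewrite -(Radon_Nikodym_change_of_variables dom measurableT (bddm_integrable mu bg)).
have ig := Radon_Nikodym_integrable (nu := charge_of_finite_measure mu) dom.
have ae : ae_eq (lebesgue_rV R d) setT
    (EFin \o f) (Radon_Nikodym (charge_of_finite_measure mu) (lebesgue_rV R d)).
  apply: ae_eq_sym; apply: integral_ae_eq => //.
  by move=> E _ mE; rewrite -Radon_Nikodym_integral// -muf.
apply: ae_eq_integral => //.
- apply: emeasurable_funM; first by apply/measurable_EFinP; exact: bg.1.
  exact: (measurable_int _ ig).
- by apply/measurable_EFinP; apply: measurable_funM => //; exact: bg.1.
by apply: filterS ae => x h _; rewrite EFinM -h.
Qed.

End euclidean_support.

Section log_concave_prekopa.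
Context {R : realType} {d : nat}.
Variables (X : set 'rV[R]_d) (mu : probability 'rV[R]_d R) (f : 'rV[R]_d -> R).
Hypothesis mX : measurable X.
Hypothesis aeX : {ae mu, forall x, X x}.
Hypothesis convX : forall x y, X x -> X y -> X (2^-1 *: (x + y)).
Hypothesis densf : is_density mu f.
Hypothesis logf : log_concave_on X f.

Let log_concave_midpoint x y : X x -> X y ->
  f x * f y <= f (2^-1 *: (x + y)) ^+ 2.
Proof.
move=> Xx Xy; have [_ f0 _] := densf.
have h2 : 0 <= (2^-1 : R) <= 1 by apply/andP; split; lra.
have := @logf x y 2^-1 Xx Xy h2.
rewrite (_ : 1 - 2^-1 = 2^-1 :> R); last by field.
rewrite -scalerDr !powR12_sqrt// => h.
rewrite -[leLHS](_ : (Num.sqrt (f x) * Num.sqrt (f y)) ^+ 2 = _); last first.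
  by rewrite exprMn !sqr_sqrtr.
by rewrite lerXn2r// nnegrE ?mulr_ge0 ?sqrtr_ge0.
Qed.

(** Log-concavity is available on [X] only, so the Prekopa-Leindler inequality is applied to
    exponential times indicator times density: off [X] the left side vanishes, and [mu] does not see
    the indicator. *)
Lemma prekopa_log_concave (u v w : 'rV[R]_d -> R) : bddm u -> bddm v -> bddm w ->
  (forall x y, X x -> X y -> (u x + v y) / 2 <= w (2^-1 *: (x + y))) ->
  (\int[mu]_x expR (u x)) * (\int[mu]_x expR (v x)) <=
  (\int[mu]_x expR (w x)) ^+ 2.
Proof.
move=> bu bv bw uvw; have [mf f0 _] := densf.
pose g (k : 'rV[R]_d -> R) x := expR (k x) * \1_X x.
have b1 : bddm (\1_X : 'rV[R]_d -> R).
  split; first exact: measurable_indic.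
  by exists 1 => x; rewrite indicE; case: (_ \in _); rewrite ?normr1 ?normr0.
have bg k : bddm k -> bddm (g k).
  by move=> bk; apply: bddmM => //; exact: bddm_expR.
have g0 k x : 0 <= g k x by rewrite mulr_ge0 ?expR_ge0.
have gE k : bddm k -> ((\int[mu]_x expR (k x))%:E =
    \int[lebesgue_rV R d]_x (g k x * f x)%:E)%E.
  move=> bk; rewrite -(mean_density densf (bg _ bk)).
  rewrite -[RHS]fineK; last first.
    by apply: integrable_fin_num => //; exact/bddm_integrable/bg.
  congr EFin; apply: ae_eq_mean; [exact: (bddm_expR bk).1|exact: (bg _ bk).1|].
  by apply: filterS aeX => x Xx; rewrite /g indicE mem_set// mulr1.
rewrite -lee_fin expr2 !EFinM (gE u bu) (gE v bv) (gE w bw).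
have mgf k : bddm k -> measurable_fun setT (fun x => (g k x * f x)%:E).
  by move=> bk; apply/measurable_EFinP/measurable_funM => //; exact: (bg _ bk).1.
have gf0 k x : (0 <= (g k x * f x)%:E)%E by rewrite lee_fin mulr_ge0.
apply: (@prekopa_leindler_rV R d _ _ _ (mgf _ bu) (mgf _ bv) (mgf _ bw)
  (gf0 u) (gf0 v) (gf0 w)) => x y.
rewrite -!EFinM lee_fin /g !indicE.
have [Xx|nXx] := boolP (x \in X); last first.
  by rewrite mulr0 !mul0r mulr_ge0// mulr_ge0// mulr_ge0 ?expR_ge0.
have [Xy|nXy] := boolP (y \in X); last first.
  by rewrite mulr0 mul0r mulr0 mulr_ge0// mulr_ge0// mulr_ge0 ?expR_ge0.
rewrite !inE in Xx Xy; have Xm := convX Xx Xy.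
rewrite mem_set// !mulr1 -!expr2 exprMn mulrACA; apply: ler_pM.
- by rewrite mulr_ge0 ?expR_ge0.
- by rewrite mulr_ge0.
- by rewrite -expRD -expRM_natr ler_expR -ler_pdivrMr//; exact: uvw.
- exact: log_concave_midpoint.
Qed.

End log_concave_prekopa.

Lemma ae_ex {R : realType} {d} {T : measurableType d} (P : probability T R)
    (A : set T) : {ae P, forall x, A x} -> A !=set0.
Proof.
move=> aeA; apply/set0P/eqP => A0.
have : (P setT = 0)%E.
  apply: measure_negligible => //; move: aeA; apply: negligibleS => x _ /=.
  by rewrite A0.
rewrite [LHS]probability_setT => -[] /eqP; apply/negP; exact: oner_neq0.
Qed.

Section dual_upper_bound.
Context {R : realType} {d1 d2 : measure_display}.
Context {T1 : measurableType d1} {T2 : measurableType d2}.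
Variables (mu : probability T1 R) (nu : probability T2 R).
Variables (c : T1 -> T2 -> R) (lambda : R).
Hypothesis lambda0 : 0 < lambda.
Hypothesis bc : bddm (fun z : T1 * T2 => c z.1 z.2).

Let bound_arith (M r s k : R) : 1 + (r + s - M) / lambda <= k ->
  r + s + lambda * (1 - k) <= M.
Proof.
by rewrite -lerBrDl ler_pdivrMr// mulrC; lra.
Qed.

(** Integrate [1 + z <= expR z] over both variables. The bound makes the dual supremum finite. *)
Lemma dual_fun_le (M : R) phi psi : bddm phi -> bddm psi ->
  (forall x y, c x y <= M) -> dual_fun mu nu c lambda phi psi <= M.
Proof.
move=> bphi bpsi cM; rewrite /dual_fun.
have bk := bddm_plan lambda bc bphi bpsi.
have [bI _ _] := mean_fubini mu nu bk.
pose a := \int[mu]_x phi x.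
have inner y : 1 + (a + psi y - M) / lambda <=
    \int[mu]_x expR ((phi x + psi y - c x y) / lambda).
  have b1 : bddm (fun x => phi x + (psi y - M)).
    by apply: bddmD => //; exact: bddm_cst.
  have -> : 1 + (a + psi y - M) / lambda =
      \int[mu]_x (1 + (phi x + (psi y - M)) / lambda).
    rewrite meanD; [|exact: bddm_cst|by apply: bddmM => //; exact: bddm_cst].
    rewrite mean_cst meanZr// meanD//; last exact: bddm_cst.
    by rewrite mean_cst addrA.
  apply: le_mean.
  - apply: bddmD; first exact: bddm_cst.
    by apply: bddmM => //; exact: bddm_cst.
  - exact: (bddm_section1 y bk).
  move=> x; apply: le_trans (expR_ge1Dx _); rewrite lerD2l ler_pM2r ?invr_gt0//.
  by rewrite addrA lerB.
have outer : 1 + (a + \int[nu]_y psi y - M) / lambda <=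
    \int[nu]_y \int[mu]_x expR ((phi x + psi y - c x y) / lambda).
  have b1 : bddm (fun y => a + psi y) by apply: bddmD => //; exact: bddm_cst.
  have b2 : bddm (fun y => a + psi y - M) by apply: bddmB => //; exact: bddm_cst.
  have -> : 1 + (a + \int[nu]_y psi y - M) / lambda =
      \int[nu]_y (1 + (a + psi y - M) / lambda).
    rewrite meanD; [|exact: bddm_cst|by apply: bddmM => //; exact: bddm_cst].
    rewrite mean_cst meanZr// meanB//; last exact: bddm_cst.
    rewrite meanD//; last exact: bddm_cst.
    by rewrite !mean_cst.
  apply: le_mean => //; apply: bddmD; first exact: bddm_cst.
  by apply: bddmM => //; exact: bddm_cst.
exact: bound_arith outer.
Qed.

End dual_upper_bound.

(** * Linear convergence for bounded costs and potentials *)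

Section linear_rate.
Context {R : realType} {d1 d2 : measure_display}.
Context {T1 : measurableType d1} {T2 : measurableType d2}.
Variables (mu : probability T1 R) (nu : probability T2 R).
Variables (c : T1 -> T2 -> R) (lambda C : R).
Hypothesis lambda0 : 0 < lambda.
Hypothesis bc : bddm (fun z : T1 * T2 => c z.1 z.2).
Hypothesis lambdaC : lambda <= C.
Hypothesis oscX : forall x x' y, c x y - c x' y <= C.
Hypothesis prekopa : forall psi psi', bddm psi -> bddm psi' ->
  (\int[mu]_x expR (transformY nu c lambda psi x / (2 * C))) *
    (\int[mu]_x expR (transformY nu c lambda psi' x / (2 * C))) <=
  (\int[mu]_x expR (transformY nu c lambda
    (fun y => (psi y + psi' y) / 2) x / (2 * C))) ^+ 2.

Let value psi t := dual_fun mu nu c lambda (sinkhorn_phi mu nu c lambda psi t)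
  (sinkhorn_psi mu nu c lambda psi t).

Let geometric (alpha S e e' : R) : 0 < alpha -> S - e <= alpha * (e' - e) ->
  S - e' <= (1 - alpha^-1) * (S - e).
Proof.
move=> a0; rewrite -ler_pdivrMl// => h.
by rewrite mulrBl mul1r; move: h; move: (alpha^-1 * _) => r; lra.
Qed.

Lemma sinkhorn_linear_rate (psi : T2 -> R) (S : R) (t : nat) : bddm psi ->
  (forall phi psi, bddm phi -> bddm psi -> dual_fun mu nu c lambda phi psi <= S) ->
  (forall e, 0 < e -> exists phi psi,
    [/\ bddm phi, bddm psi & S - e < dual_fun mu nu c lambda phi psi]) ->
  S - value psi t <=
    (S - value psi 0) * (1 - (176 * (C / lambda))^-1) ^+ t.
Proof.
move=> bpsi FS FSe; set alpha := 176 * (C / lambda).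
have Cl : 1 <= C / lambda by rewrite ler_pdivlMr// mul1r.
(* This makes [1 - alpha^-1] nonnegative, so the induction hypothesis may be multiplied by it. *)
have alpha1 : 1 <= alpha.
  by rewrite /alpha -[leLHS]mul1r; apply: ler_pM => //; rewrite ler1n.
have alpha0 : 0 < alpha by exact: lt_le_trans alpha1.
have bt n : bddm (sinkhorn_psi mu nu c lambda psi n).
  elim: n => [//|n IHn].
  exact/(bddm_transformX mu lambda bc)/(bddm_transformY nu lambda bc).
elim: t => [|t IHt]; first by rewrite expr0 mulr1.
have step := sinkhorn_step lambda0 bc lambdaC oscX prekopa (bt t) FS FSe.
apply: (le_trans (geometric alpha0 step)).
rewrite exprS mulrCA; apply: ler_wpM2l => //.
by rewrite subr_ge0 invf_le1.
Qed.

End linear_rate.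

Lemma fin_num_subE {R : realType} (a : \bar R) (x y : R) :
  a \is a fin_num -> x = y -> (a - x%:E)%E = (fine a - y)%:E.
Proof. by move=> afin ->; rewrite EFinB fineK. Qed.

Theorem theorem1p1 (R : realType) (d : nat) (X Y : set 'rV[R]_d)
  (mu nu : probability 'rV[R]_d R) (lambda : R)
  (compX : compact X) (compY : compact Y)
  (convX : convex_set (X : set (convex_lmodType 'rV[R]_d)))
  (suppmu : msupport mu = X) (suppnu : msupport nu = Y)
  (lambda_gt0 : 0 < lambda)
  (logconc : exists f : 'rV[R]_d -> R, is_density mu f /\ log_concave_on X f)
  (psi0 : 'rV[R]_d -> R) (psi0_Linfty : psi0 \in Lfun nu +oo%E)
  (t : nat) (alpha := 176 * (1 + cost_osc dot_cost X Y / lambda)) :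
  (dual_gap mu nu dot_cost lambda psi0 t <=
   dual_gap mu nu dot_cost lambda psi0 0 * ((1 - alpha^-1) ^+ t)%:E)%E.
Proof.
have aeX : {ae mu, forall x, X x} by rewrite -suppmu; exact: ae_msupport.
have aeY : {ae nu, forall y, Y y} by rewrite -suppnu; exact: ae_msupport.
have mX := compact_measurable_rV compX; have mY := compact_measurable_rV compY.
have [x0 Xx0] := ae_ex aeX; have [y0 Yy0] := ae_ex aeY.
have [M XYM] := dotp_bounded compX compY.
(* Off [X] times [Y] the cost is replaced by one of its values there. The new cost [c] thus takes
   only values attained on the supports, and inherits their bound and oscillation everywhere. *)
pose k : R := dot_cost x0 y0.
pose c (x y : 'rV[R]_d) : R := \1_X x * \1_Y y * (dot_cost x y - k) + k.
have cE x y : X x -> Y y -> dot_cost x y = c x y.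
  by move=> Xx Yy; rewrite /c !indicE !mem_set// !mul1r subrK.
have cE0 x y : ~ Y y -> c x y = k.
  by move=> nYy; rewrite /c [\1_Y y]indicE memNset// mulr0 mul0r add0r.
have crep x y : exists u v, [/\ X u, Y v & c x y = dot_cost u v].
  have [Yy|nYy] := pselect (Y y); last by exists x0, y0; rewrite cE0.
  have [Xx|nXx] := pselect (X x); first by exists x, y; rewrite cE.
  by exists x0, y0; split => //; rewrite /c indicE memNset// !mul0r add0r.
have mdot : measurable_fun setT
    (fun z : 'rV[R]_d * 'rV[R]_d => dot_cost z.1 z.2).
  by apply: measurableT_comp => //; exact: measurable_dotp.
have mc : measurable_fun setT (fun z : 'rV[R]_d * 'rV[R]_d => c z.1 z.2).
  apply: measurable_funD => //; apply: measurable_funM; last exact: measurable_funB.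
  apply: measurable_funM.
    exact: (measurableT_comp (measurable_indic mX) measurable_fst).
  exact: (measurableT_comp (measurable_indic mY) measurable_snd).
have cM x y : `|c x y| <= M.
  by have [u [v [Xu Yv ->]]] := crep x y; rewrite normrN; exact: XYM.
have bc : bddm (fun z : 'rV[R]_d * 'rV[R]_d => c z.1 z.2).
  by split => //; exists M => z.
have cosc x x' y y' : c x y - c x' y' <= cost_osc dot_cost X Y.
  have [u [v [Xu Yv ->]]] := crep x y; have [u' [v' [Xu' Yv' ->]]] := crep x' y'.
  exact: dot_cost_osc.
(* Adding [lambda] ensures [lambda <= C], and [176 * (C / lambda)] is then exactly [alpha]. *)
pose C := lambda + cost_osc dot_cost X Y.
have osc0 : 0 <= cost_osc dot_cost X Y by rewrite -(subrr (c x0 y0)).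
have lambdaC : lambda <= C by rewrite lerDl.
have C0 : 0 < C by exact: lt_le_trans lambdaC.
have oscX x x' y : c x y - c x' y <= C.
  by rewrite (le_trans (cosc _ _ _ _))// lerDr ltW.
have midX x x' : X x -> X x' -> X (2^-1 *: (x + x')).
  move=> Xx Xx'.
  have h0 : 0 <= 2^-1 :> R by rewrite invr_ge0.
  have h1 : 2^-1 <= 1 :> R by rewrite invf_le1// ler1n.
  have : X (2^-1 *: x + (1 - 2^-1) *: x').
    by have := convX x x' (Itv01 h0 h1); rewrite !inE => /(_ Xx Xx').
  by rewrite (_ : 1 - 2^-1 = 2^-1 :> R) ?scalerDr//; field.
(* The linear cost satisfies this with equality for [y] in [Y], and off [Y] the cost [c] is
   constant. *)
have cmid x x' y : X x -> X x' ->
    (c x y + c x' y) / 2 <= c (2^-1 *: (x + x')) y.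
  move=> Xx Xx'; have [Yy|nYy] := pselect (Y y); last first.
    by rewrite !cE0// mulrDl -splitr.
  rewrite -!cE//; last exact: midX.
  rewrite /dot_cost -opprD mulNr lerN2 /dotp -big_split/= mulr_suml.
  by apply: ler_sum => i _; rewrite !mxE -mulrDl -mulrA mulrC.
have [f [densf logf]] := logconc.
have prekopa psi psi' : bddm psi -> bddm psi' ->
    (\int[mu]_x expR (transformY nu c lambda psi x / (2 * C))) *
    (\int[mu]_x expR (transformY nu c lambda psi' x / (2 * C))) <=
    (\int[mu]_x expR (transformY nu c lambda
      (fun y => (psi y + psi' y) / 2) x / (2 * C))) ^+ 2.
  move=> bpsi bpsi'.
  have bdiv (g : 'rV[R]_d -> R) : bddm g -> bddm (fun x => g x / (2 * C)).
    by move=> bg; apply: bddmM => //; exact: bddm_cst.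
  have bm : bddm (fun y => (psi y + psi' y) / 2).
    by apply: bddmM; [exact: bddmD|exact: bddm_cst].
  apply: (prekopa_log_concave mX aeX midX densf logf).
  - exact/bdiv/(bddm_transformY nu lambda bc).
  - exact/bdiv/(bddm_transformY nu lambda bc).
  - exact/bdiv/(bddm_transformY nu lambda bc).
  move=> x x' Xx Xx'; rewrite -mulrDl mulrAC ler_pM2r ?invr_gt0 ?mulr_gt0//.
  apply: (transformX_midpoint nu (c := fun y x => c x y) lambda_gt0
    (bddm_swap bc)) => // y.
  exact: cmid.
have FE phi psi : bddm phi -> bddm psi ->
    dual_fun mu nu dot_cost lambda phi psi = dual_fun mu nu c lambda phi psi.
  move=> [mphi _] [mpsi _].
  exact: (dual_fun_ae lambda mdot mc aeX aeY cE mphi mphi mpsi mpsi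
    (nearW _ (fun=> erefl)) (nearW _ (fun=> erefl))).
set s := dual_sup mu nu dot_cost lambda.
(* Each admissible pair has the dual value of an everywhere bounded pair for the cost [c], so the
   supremum may be computed on the latter. *)
have repr p : p.1 \in Lfun mu +oo%E /\ p.2 \in Lfun nu +oo%E ->
    exists phi psi, [/\ bddm phi, bddm psi &
      dual_fun mu nu dot_cost lambda p.1 p.2 = dual_fun mu nu c lambda phi psi].
  move=> [/Lfun_bddm[m1 [phi bphi ae1]] /Lfun_bddm[m2 [psi bpsi ae2]]].
  exists phi, psi; split; [exact: bphi|exact: bpsi|].
  exact: (dual_fun_ae lambda mdot mc aeX aeY cE m1 bphi.1 m2 bpsi.1 ae1 ae2).
have sM : (s <= M%:E)%E.
  apply: ge_ereal_sup => _ [p /repr[phi [psi [bphi bpsi ->]]] <-].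
  rewrite lee_fin; apply: dual_fun_le => // x y.
  exact: le_trans (ler_norm _) (cM x y).
have Fs phi psi : bddm phi -> bddm psi ->
    ((dual_fun mu nu c lambda phi psi)%:E <= s)%E.
  move=> bphi bpsi; rewrite -FE//; apply: ereal_sup_ubound.
  by exists (phi, psi) => //; split; exact: bddm_Lfun.
have sfin : s \is a fin_num.
  rewrite fin_numElt (le_lt_trans sM) ?ltry// andbT.
  exact: (lt_le_trans (ltNyr _) (Fs _ _ (bddm_cst 0) (bddm_cst 0))).
pose S := fine s.
have FS phi psi : bddm phi -> bddm psi -> dual_fun mu nu c lambda phi psi <= S.
  by move=> bphi bpsi; rewrite -lee_fin fineK// Fs.
have FSe e : 0 < e -> exists phi psi,
    [/\ bddm phi, bddm psi & S - e < dual_fun mu nu c lambda phi psi].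
  move=> e0; have : ((S - e)%:E < s)%E.
    by rewrite -[ltRHS]fineK// lte_fin ltrBlDr ltrDl.
  move=> /ereal_sup_gt[_ [p /repr[phi [psi [bphi bpsi Fp]]] <-]].
  rewrite Fp lte_fin => Se.
  by exists phi, psi; split; [exact: bphi|exact: bpsi|exact: Se].
(* The iterates started from the bounded representative [psi] with cost [c] agree almost everywhere
   with the original ones, hence have the same gaps. *)
have [mpsi0 [psi bpsi ae0]] := Lfun_bddm psi0_Linfty.
have gapE n : dual_gap mu nu dot_cost lambda psi0 n =
    (S - dual_fun mu nu c lambda (sinkhorn_phi mu nu c lambda psi n)
      (sinkhorn_psi mu nu c lambda psi n))%:E.
  exact: (fin_num_subE sfin
    (dual_sinkhorn_ae lambda mdot mc aeX aeY cE n mpsi0 bpsi.1 ae0)).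
have alphaE : alpha = 176 * (C / lambda).
  by rewrite /alpha (mulrDl lambda) divff ?gt_eqF.
rewrite !gapE -EFinM lee_fin alphaE.
exact: (sinkhorn_linear_rate lambda_gt0 bc lambdaC oscX prekopa).
Qed.
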